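(* Let $G$ be a locally compact compactly generated group and let $f:\mathbb{R}_+\to\mathbb{R}_+$ be a nondecreasing function satisfying $$\int_1^{\infty}\left(\frac{f(t)}{J^b_{G,p}(t)}\right)^p\frac{dt}{t}<\infty$$ for some $1<p<\infty$. Then there exists a $1$-cocycle $b\in Z^1(G,\lambda_{G,p})$ whose compression $\rho$ satisfies $\rho\succeq f$.
   Context: **$L^p$-isoperimetric profile inside balls.** Let $\mu$ be a left Haar measure on $G$, $S$ a compact symmetric generating subset, $|g|_S=\inf\{n\in\mathbb{N}: g\in S^n\}$ and $B(1,t)$ the ball of radius $t$ around $1$ for $|\cdot|_S$. For a function $\varphi$ on $G$ put $|\tilde{\nabla}\varphi|(g)=\sup_{s\in S}|\varphi(sg)-\varphi(g)|$. Then $$J^b_{G,p}(t)=\sup_{\varphi}\frac{\|\varphi\|_p}{\|\tilde{\nabla}\varphi\|_p},$$ where the supremum is over all nonzero measurable functions $\varphi\in L^p(G,\mu)$ with support in $B(1,t)$. **Cocycles.** For an isometric (continuous linear) representation $\pi$ of $G$ on a Banach space $E$, $Z^1(G,\pi)$ is the set of continuous maps $b:G\to E$ with $b(gh)=\pi(g)b(h)+b(g)$ for all $g,h\in G$. The compression of $b$ is $\rho(t)=\inf_{|g|_S\geq t}\|b(g)\|\in[0,\infty]$. The left regular representation $\lambda_{G,p}$ on $L^p(G)=L^p(G,\mu)$ is $\lambda_{G,p}(g)\varphi=\varphi(g^{-1}\cdot)$. **Asymptotic comparison.** For nondecreasing nonzero functions $f,g:\mathbb{R}_+\to[0,\infty]$,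 $f\preceq g$ (equivalently $g\succeq f$) means that there exists $C>0$ such that $f(t)=O(g(Ct))$ as $t\to\infty$. *)

(* Defs.v *)
From HB Require Import structures.
From mathcomp Require Import all_boot all_order all_algebra.
From mathcomp Require Import all_classical all_reals all_analysis.

Set Implicit Arguments.
Unset Strict Implicit.
Unset Printing Implicit Defensive.
Import Order.TTheory GRing.Theory Num.Theory.
Import numFieldNormedType.Exports.
Local Open Scope classical_set_scope.
Local Open Scope ring_scope.

(* The distinguished point carries no information; it is only there because
   sigma-algebras are put on pointed types. *)
HB.mixin Record isTopologicalGroup G of Group G & PointedTopological G := {
  mulg_continuous : continuous (fun x : G * G => (x.1 * x.2)%g) ;
  invg_continuous : continuous (fun x : G => x^-1%g)
}.

#[short(type="topologicalGroupType")]
HB.structure Definition TopologicalGroup :=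
  {G of Group G & PointedTopological G & isTopologicalGroup G}.

Notation borelType G := (g_sigma_algebraType (@open G)).

Section word_metric.
Context (R : realType) (G : groupType).
Implicit Types (S : set G) (g : G) (n : nat).

(* S^n, with S^0 = {1} *)
Fixpoint set_expg S n : set G :=
  if n is m.+1 then [set (x * y)%g | x in S & y in set_expg S m] else [set 1%g].

Definition symmetric_set S := forall g, S g -> S g^-1%g.

(* For symmetric S, the union of the S^n is the subgroup generated by S. *)
Definition generating_set S := \bigcup_n set_expg S n = setT.

(* Equal to +oo outside the subgroup generated by S. *)
Definition word_length S g : \bar R :=
  ereal_inf [set (n%:R)%:E | n in [set n | set_expg S n g]].

Definition word_ball S (t : R) : set G :=
  [set g | (word_length S g <= t%:E)%E].

End word_metric.

Section haar.
Context (R : realType) (G : topologicalGroupType).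
Local Open Scope ereal_scope.

Record left_haar (mu : {measure set (borelType G) -> \bar R}) : Prop := {
  haar_compact : forall K : set G, compact K -> mu K < +oo ;
  haar_outer_regular : forall A : set (borelType G), measurable A ->
    mu A = ereal_inf [set mu U | U in [set U : set G | open U /\ A `<=` U]] ;
  haar_inner_regular : forall U : set G, open U ->
    mu U = ereal_sup [set mu K | K in [set K : set G | compact K /\ K `<=` U]] ;
  haar_left_invariant : forall (g : G) (A : set (borelType G)), measurable A ->
    mu [set (g * x)%g | x in (A : set G)] = mu A ;
  haar_neq0 : mu setT != 0
}.

Context (mu : {measure set (borelType G) -> \bar R}) (S : set G) (p : R).

(* The supremum is taken in [0, +oo]: the value is 0 when S is empty. *)
Definition grad (phi : G -> R) : borelType G -> \bar R := fun g : G =>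
  maxe 0 (ereal_sup [set (`|phi (s * g)%g - phi g|%R)%:E | s in S]).

(* The supremum is again taken in [0, +oo], so it is 0 when no function is
   admissible.  The quotient is +oo when the gradient has norm 0.  If the
   gradient of phi is not measurable, its Lnorm is given by the lower integral,
   since \int is a supremum over simple functions below the integrand. *)
Definition isoperimetric_profile (t : R) : \bar R :=
  maxe 0 (ereal_sup
    [set 'N[mu]_p%:E[EFin \o phi] / 'N[mu]_p%:E[grad phi] |
       phi in [set phi : borelType G -> R |
         [/\ phi \in Lfun mu p%:E,
             ~ (phi = cst 0%R %[ae mu]) &
             [set g | phi g != 0%R] `<=` word_ball S t]]]).

End haar.

Section cocycles.
Context (R : realType) (G : topologicalGroupType).
Context (mu : {measure set (borelType G) -> \bar R}).

Lemma exponent_ge1 (p : R) : 1 < p -> (1 <= p%:E)%E.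
Proof. by move=> p1; rewrite lee_fin ltW. Qed.

Definition left_regular (g : G) (phi : borelType G -> R) : borelType G -> R :=
  fun x : G => phi (g^-1 * x)%g.

Context (p : \bar R) (p1 : (1 <= p)%E).

(* Z^1(G, lambda_{G,p}).  Elements of LspaceType are classes of functions,
   coerced to representatives: equality in L^p is equality mu-a.e. of the
   representatives, and continuity is for the L^p norm. *)
Record left_regular_cocycle (b : G -> LspaceType mu p1) : Prop := {
  cocycle_continuous : forall g : G,
    ('N[mu]_p[EFin \o (b h \- b g)%R])%E @[h --> g] --> 0%E ;
  cocycleM : forall g h : G,
    b (g * h)%g = left_regular g (b h) \+ b g %[ae mu]
}.

(* Infimum in [0, +oo]: it is +oo if no g satisfies the constraint. *)
Definition compression (S : set G) (b : G -> LspaceType mu p1) (t : R) : \bar R :=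
  ereal_inf [set ('N[mu]_p[EFin \o b g])%E |
               g in [set g | (t%:E <= word_length R S g)%E]].

End cocycles.

(* f(t) = O(g(C t)) as t -> +oo, for some C > 0 *)
Definition asymp_le (R : realType) (f g : R -> \bar R) :=
  exists2 C : R, 0 < C &
  exists2 M : R, 0 < M & \forall t \near +oo, (f t <= M%:E * g (C * t)%R)%E.

(* Main.v *)
Require Import Defs.
From HB Require Import structures.
From mathcomp Require Import all_boot all_order all_algebra.
From mathcomp Require Import all_classical all_reals all_analysis.
From mathcomp Require Import measurable_realfun ring lra zify.
Import Order.TTheory GRing.Theory Num.Theory.
Import numFieldNormedType.Exports.
Local Open Scope classical_set_scope.
Local Open Scope ring_scope.

(* If [G] is bounded for the word metric, [b = 0] works.  Otherwise put
   [a_k = f (2^k) / J (2^(k+1))]; comparing the integral with a sum over dyadic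
   intervals gives [sum_k a_k^p < oo], so there are nonnegative [psi_k] supported
   in the ball of radius [2^(k+1)] with [|psi_k|_p = f (2^k)] and gradients [e_k]
   such that [sum_k e_k^p < oo].  Right translations commute with the left
   regular representation and, Haar measure being unique, multiply the [L^p]
   norm by a constant, so [psi_k] may be moved to a ball [D_k] centred at an
   element of length [2^(k+6)]; the [D_k] are then so far apart that
   [Psi = sum_k psi_k] satisfies [|Psi - lambda(s) Psi|_p^p <= sum_k e_k^p] for
   [s] in [S].  Although [Psi] need not be in [L^p], the formal coboundary
   [b g = Psi - lambda(g) Psi] is therefore a cocycle with values in [L^p].  If
   [2^(k+2) < |g| <= 2^(k+3)], then [b g = psi_k] on [D_k], whence
   [|b g|_p >= f (2^k) >= f (|g| / 8)].

   Uniqueness of Haar measure is needed without second countability, where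
   Borel sets of [G * G] may fail to be product measurable.  Fubini's theorem is
   replaced by the inequality [nu K * mu V <= mu E * nu V], valid for a
   symmetric open [V] with [K V] inside [E], which only involves finitely many
   translates. *)

Set Implicit Arguments.
Unset Strict Implicit.
Unset Printing Implicit Defensive.

(** * Translations in topological groups *)

Section translations.
Context (G : topologicalGroupType).
Implicit Types (g x y : G) (K U V : set G).

Lemma mul_continuous_at x y (U : set G) : nbhs (x * y)%g U ->
  \forall x' \near x & y' \near y, U (x' * y')%g.
Proof. exact: (@mulg_continuous G (x, y)). Qed.

Lemma mulgl_continuous g : continuous (fun x : G => (g * x)%g).
Proof.
move=> x; apply: (@continuous2_cvg _ _ _ _ _ _ (fun _ => g) id
  (fun a b : G => (a * b)%g)).
- exact: (@mulg_continuous G (g, x)).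
- exact: cvg_cst.
- exact: cvg_id.
Qed.

Lemma mulgr_continuous g : continuous (fun x : G => (x * g)%g).
Proof.
move=> x; apply: (@continuous2_cvg _ _ _ _ _ _ id (fun _ => g)
  (fun a b : G => (a * b)%g)).
- exact: (@mulg_continuous G (x, g)).
- exact: cvg_id.
- exact: cvg_cst.
Qed.

Lemma image_mulgl g (A : set G) :
  [set (g * x)%g | x in A] = [set x | A (g^-1 * x)%g].
Proof.
apply/seteqP; split => [_ [x Ax <-]|x /= Ax]; first by rewrite /= mulKg.
by exists (g^-1 * x)%g => //; rewrite mulgA mulgV mul1g.
Qed.

Lemma image_mulgr g (A : set G) :
  [set (x * g)%g | x in A] = [set x | A (x * g^-1)%g].
Proof.
apply/seteqP; split => [_ [x Ax <-]|x /= Ax]; first by rewrite /= mulgK.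
by exists (x * g^-1)%g => //; rewrite mulgVK.
Qed.

Lemma open_mulgl g U : open U -> open [set x | U (g * x)%g].
Proof. by move=> oU; apply: open_comp => // x _; exact: mulgl_continuous. Qed.

Lemma open_mulgr g U : open U -> open [set x | U (x * g)%g].
Proof. by move=> oU; apply: open_comp => // x _; exact: mulgr_continuous. Qed.

Lemma open_invg U : open U -> open [set x | U x^-1%g].
Proof. by move=> oU; apply: open_comp => // x _; exact: invg_continuous. Qed.

Lemma compact_mulgr g K : compact K -> compact [set x | K (x * g)%g].
Proof.
move=> cK; have := image_mulgr g^-1%g K; rewrite invgK => <-.
by apply: continuous_compact => //; apply: continuous_subspaceT;
  exact: mulgr_continuous.
Qed.

Lemma compact_set_mulg (K L : set G) : compact K -> compact L ->
  compact [set (x * y)%g | x in K & y in L].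
Proof.
move=> cK cL.
have -> : [set (x * y)%g | x in K & y in L] =
    (fun z : G * G => (z.1 * z.2)%g) @` (K `*` L).
  apply/seteqP; split => [_ [x Kx [y Ly <-]]|_ [[x y] [/= Kx Ly] <-]].
    by exists (x, y).
  by exists x => //; exists y.
apply: continuous_compact; last exact: compact_setX.
by apply: continuous_subspaceT; exact: mulg_continuous.
Qed.

Lemma compact_set_expg (S : set G) n : compact S -> compact (set_expg S n).
Proof.
move=> cS; elim: n => [|n IH] /=; first exact: compact_set1.
exact: compact_set_mulg.
Qed.

(** A tube-lemma argument: continuity of multiplication gives both inclusions locally around each
    point of [K], and compactness, in the form of [compact_near_coveringP], makes the neighbourhood
    of [1] uniform in [x]. *)
Lemma near_compact_mul K U : compact K -> open U -> K `<=` U ->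
  \forall v \near (1%g : G), forall x, K x -> U (v * x)%g /\ U (x * v)%g.
Proof.
move=> /compact_near_coveringP cK oU KU.
apply: (cK G (nbhs (1%g : G)) (fun v x => U (v * x)%g /\ U (x * v)%g)) => x Kx.
have nU : nbhs x U by apply: open_nbhs_nbhs; split => //; exact: KU.
apply: filterI.
  have /mul_continuous_at[[/= P Q] [P1 Qx] PQ] : nbhs (1 * x)%g U by rewrite mul1g.
  exists (Q, P) => // -[a b] [/= Qa Pb]; exact: (PQ (b, a)).
have /mul_continuous_at[[/= P Q] [Px Q1] PQ] : nbhs (x * 1)%g U by rewrite mulg1.
exists (P, Q) => // -[a b] [/= Pa Qb]; exact: (PQ (a, b)).
Qed.

Lemma symmetric_open_nbhd {P : set G} : nbhs (1%g : G) P -> exists V : set G,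
  [/\ open V, V 1%g, (forall x, V x -> V x^-1%g) & V `<=` P].
Proof.
rewrite nbhsE => -[U [oU U1] UP].
exists (U `&` [set x | U x^-1%g]); split.
- by apply: openI => //; exact: open_invg.
- by split => //=; rewrite invg1.
- by move=> x [Ux Ux']; split => //=; rewrite invgK.
- by move=> x [/UP].
Qed.

End translations.

(** * Haar measure and its uniqueness *)

Section borel.
Context (G : topologicalGroupType).

Lemma measurable_open (U : set G) : open U -> measurable (U : set (borelType G)).
Proof. by move=> oU; exact: sub_sigma_algebra. Qed.

Lemma measurable_compact (K : set G) : hausdorff_space G -> compact K ->
  measurable (K : set (borelType G)).
Proof.
move=> hG cK; rewrite -[K]setCK; apply: measurableC; apply: measurable_open.
by rewrite openC; exact: compact_closed.
Qed.

Lemma continuous_borel (f : G -> G) : continuous f ->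
  measurable_fun setT (f : borelType G -> borelType G).
Proof.
move=> /continuousP cf.
apply: (@measurability _ _ (borelType G) (borelType G) setT f (@open G)) => //.
move=> _ [U oU <-]; rewrite setTI.
by apply: measurable_open; exact: cf.
Qed.

Lemma measurable_mulgl g :
  measurable_fun setT ((fun x : G => (g * x)%g) : borelType G -> borelType G).
Proof. by apply: continuous_borel; exact: mulgl_continuous. Qed.

Lemma measurable_mulgr g :
  measurable_fun setT ((fun x : G => (x * g)%g) : borelType G -> borelType G).
Proof. by apply: continuous_borel; exact: mulgr_continuous. Qed.

Lemma measurable_set_mulgl g (A : set (borelType G)) : measurable A ->
  measurable ([set x : G | A (g * x)%g] : set (borelType G)).
Proof. by move=> mA; rewrite -[X in measurable X]setTI; exact: measurable_mulgl. Qed.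

Lemma measurable_set_mulgr g (A : set (borelType G)) : measurable A ->
  measurable ([set x : G | A (x * g)%g] : set (borelType G)).
Proof. by move=> mA; rewrite -[X in measurable X]setTI; exact: measurable_mulgr. Qed.

Lemma measurable_set_invg_mulgr x (V : set G) : open V ->
  measurable ([set z : G | V (z^-1 * x)%g] : set (borelType G)).
Proof.
move=> oV; apply: measurable_open; rewrite -[[set _ | _]]/
  [set z | [set w | V (w * x)%g] z^-1%g].
by apply: open_invg; exact: open_mulgr.
Qed.

Lemma compact_finite_cover (K N : set G) : compact K -> open N -> N 1%g ->
  exists s : seq G, forall z, K z -> exists2 y, y \in s & N (y^-1 * z)%g.
Proof.
rewrite compact_cover => cK oN N1.
have [|z Kz|D _ KD] := cK _ K (fun y : G => [set x | N (y^-1 * x)%g]).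
- by move=> y _; exact: open_mulgl.
- by exists z => //=; rewrite mulVg.
exists (finmap.enum_fset D) => z /KD[y /= yD Nyz]; by exists y.
Qed.

End borel.

Lemma measure_le d (T : measurableType d) (R : realType)
    (mu : {measure set T -> \bar R}) (A B : set T) :
  measurable A -> measurable B -> A `<=` B -> (mu A <= mu B)%E.
Proof. by move=> mA mB; apply: le_measure; rewrite inE. Qed.

Section haar_basics.
Context (R : realType) (G : topologicalGroupType) (hG : hausdorff_space G).
Context {mu : {measure set (borelType G) -> \bar R}} (hmu : left_haar mu).
Local Open Scope ereal_scope.
Implicit Types (K U V : set G).

Lemma haar_mulgl g (A : set (borelType G)) : measurable A ->
  mu [set x : G | A (g * x)%g] = mu A.
Proof.
move=> mA; rewrite -(haar_left_invariant hmu g^-1%g mA) image_mulgl.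
by rewrite invgK.
Qed.

(** If [mu U] vanished, finitely many translates of the null set [x^-1 U] would cover any compact
    set. All compact sets would be null, and inner regularity would make [mu] zero. *)
Lemma haar_open_gt0 U (x : G) : open U -> U x -> 0 < mu U.
Proof.
move=> oU Ux; rewrite lt0e measure_ge0 andbT; apply/eqP => U0.
have /negP := haar_neq0 hmu; apply.
rewrite (haar_inner_regular hmu (@openT G)) eq_le; apply/andP; split; last first.
  apply: ereal_sup_ubound; exists set0; last exact: measure0.
  by split; [exact: compact0|].
apply: ge_ereal_sup => _ [K [cK _] <-].
pose N := [set z : G | U (x * z)%g].
have oN : open N by exact: open_mulgl.
have N1 : N 1%g by rewrite /N /= mulg1.
have N0 : mu N = 0 by rewrite haar_mulgl// ; exact: measurable_open.
have [s Ks] := compact_finite_cover cK oN N1.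
have {Ks} : K `<=` \big[setU/set0]_(y <- s) [set z : G | N (y^-1 * z)%g].
  move=> z /Ks[y ys Nyz]; rewrite -bigcup_seq; by exists y.
have mK := measurable_compact hG cK.
(* Compactness of [K] is dropped: what remains after removing one null translate is only known to be
   measurable. *)
elim: s K {cK} mK => [|y s IH] K mK.
  by rewrite big_nil subset0 => ->; rewrite measure0.
rewrite big_cons => Ks.
have my : measurable ([set z : G | N (y^-1 * z)%g] : set (borelType G)).
  by apply: measurable_set_mulgl; exact: measurable_open.
rewrite (measureDI _ _ my)// -[leRHS]adde0 leeD//; last first.
  rewrite -N0 -(haar_mulgl y^-1%g (measurable_open oN)).
  by apply: measure_le; [exact: measurableI|exact: my|exact: subIsetr].
apply: IH; first exact: measurableD.
by move=> z [Kz nz]; have [] := Ks _ Kz.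
Qed.

Lemma haar_finite_open K : compact K ->
  exists U, [/\ open U, K `<=` U & mu U < +oo].
Proof.
move=> cK; have := haar_compact hmu cK.
rewrite (haar_outer_regular hmu (measurable_compact hG cK)).
move=> /ereal_inf_lt[_ [U [oU KU] <-] Ufin]; by exists U.
Qed.

End haar_basics.
Arguments haar_mulgl {R G mu} hmu g A _.

Lemma mule_ereal_sup_le (R : realType) (X : set (\bar R)) (r c : \bar R) :
  X !=set0 -> (0 <= r)%E -> (r < +oo)%E -> (forall x, X x -> (r * x <= c)%E) ->
  (r * ereal_sup X <= c)%E.
Proof.
case: r => [r| |]// X0 r0 _ Xc; rewrite -ereal_supZl//; last exact/set0P.
by apply: ge_ereal_sup => _ [x Xx <-]; exact: Xc.
Qed.

Section haar_unique.
Context (R : realType) (G : topologicalGroupType) (hG : hausdorff_space G).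
Local Open Scope ereal_scope.
Implicit Types (K U V E : set G).

(* Stands for Fubini's theorem on [{(z, x) | z in K, V (z^-1 x)}], a set that need
   not be product measurable: [K] is cut into pieces lying in [y N] with [y] in
   [s], and [h] is the sum of the [nu]-measures of the pieces weighted by the
   indicators of [y W]. *)
Lemma haar_cross_discrete {mu nu : {measure set (borelType G) -> \bar R}}
    (hmu : left_haar mu) (hnu : left_haar nu) (V W N : set G) (s : seq G)
    (K : set (borelType G)) :
  open V -> compact W -> open N ->
  (forall u w, N u -> W w -> V (u^-1 * w)%g) ->
  measurable K -> (forall z, K z -> exists2 y, y \in s & N (y^-1 * z)%g) ->
  exists h : borelType G -> \bar R, [/\ measurable_fun setT h,
    (forall x, 0 <= h x),
    (forall x, h x <= nu (K `&` [set z : G | V (z^-1 * x)%g])) &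
    \int[mu]_x h x = nu K * mu W].
Proof.
move=> oV cW oN NWV.
have mW := measurable_compact hG cW.
have mV x := measurable_set_invg_mulgr x oV.
elim: s K => [|y s IH] K mK Ks.
  have -> : K = set0 by rewrite -subset0 => z /Ks[].
  exists (fun=> 0); split => //.
  transitivity (0 * mu W); first by rewrite mul0e integral0.
  by congr (_ * _); rewrite measure0.
pose A : set (borelType G) := [set z : G | N (y^-1 * z)%g].
have mA : measurable A by apply: measurable_set_mulgl; exact: measurable_open.
have mKA : measurable (K `&` A) by exact: measurableI.
have mKDA : measurable (K `\` A) by exact: measurableD.
have [|h [mh h0 hV hint]] := IH _ mKDA.
  move=> z [Kz nA]; have [y' + Ny'] := Ks _ Kz.
  by rewrite inE => /predU1P[yy'|]; [rewrite yy' in Ny'|exists y'].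
pose yW : set (borelType G) := [set x : G | W (y^-1 * x)%g].
have myW : measurable yW by exact: measurable_set_mulgl.
have mind : measurable_fun setT (fun x => (\1_yW x : R)%:E).
  by apply/measurable_EFinP; exact: measurable_indic.
exists (fun x => nu (K `&` A) * (\1_yW x)%:E + h x); split.
- apply: emeasurable_funD => //; exact: measurable_funeM.
- move=> x; rewrite adde_ge0// mule_ge0// lee_fin; exact: indic_ge0.
- move=> x; rewrite [leRHS](measureDI _ _ mA); last exact: measurableI.
  rewrite [leRHS]addeC leeD//; last by rewrite setDE setIAC -setDE; exact: hV.
  rewrite indicE; have [xW|xW] := boolP (x \in yW); last by rewrite mule0.
  (* Here [z^-1 x = (y^-1 z)^-1 (y^-1 x)] lies in [V], so the whole piece of [K] inside [A] is
     counted. *)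
  rewrite mule1; apply: measure_le => //.
    by apply: measurableI => //; exact: measurableI.
  move=> z [Kz Az]; split => //; split => //=.
  move: xW; rewrite inE /yW /= => xW.
  have := NWV _ _ Az xW; by rewrite invgM invgK mulgA mulgK.
- rewrite ge0_integralD//; last exact: measurable_funeM.
  rewrite ge0_integralZl//.
  rewrite integral_indic// setIT hint (haar_mulgl hmu)//.
  rewrite -ge0_muleDl//; congr (_ * _).
  by rewrite addeC -measureDI.
Qed.

(** For compact [W] inside [V], the function [h] of [haar_cross_discrete] has integral
    [nu K * mu W]. It vanishes off [E], because [z] in [K] and [z^-1 x] in [V] put [x] in [E]. It is
    at most [nu V], because by symmetry of [V] the relevant [z] lie in [x V]. Inner regularity then
    replaces [W] by [V]. *)
Lemma haar_cross_compact {mu nu : {measure set (borelType G) -> \bar R}}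
    (hmu : left_haar mu) (hnu : left_haar nu) (V K E : set G) :
  open V -> (forall x, V x -> V x^-1%g) -> compact K -> open E ->
  (forall x v, K x -> V v -> E (x * v)%g) ->
  nu K * mu V <= mu E * nu V.
Proof.
move=> oV sV cK oE KVE.
rewrite (haar_inner_regular hmu oV).
have mV x := measurable_set_invg_mulgr x oV.
have mE := measurable_open oE.
have key W : compact W -> W `<=` V -> nu K * mu W <= mu E * nu V.
  move=> cW WV.
  have [N [oN N1 sN NW]] := symmetric_open_nbhd (near_compact_mul cW oV WV).
  have [s Ks] := compact_finite_cover cK oN N1.
  have [||h [mh h0 hV hint]] := @haar_cross_discrete mu nu hmu hnu V W N s K oV cW oN _ _ Ks.
  - by move=> u w /sN Nu Ww; have [] := NW _ Nu w Ww.
  - exact: measurable_compact.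
  rewrite -hint.
  apply: (@le_trans _ _ (\int[mu]_x (nu V * (\1_E x)%:E))).
    apply: ge0_le_integral => //.
    - apply: measurable_funeM; apply/measurable_EFinP; exact: measurable_indic.
    - move=> x _; apply: le_trans (hV x) _; rewrite indicE.
      have [xE|xE] := boolP (x \in E).
        rewrite mule1 -(haar_mulgl hnu x^-1%g _ (measurable_open oV)).
        apply: measure_le => //.
        + exact: measurableI (measurable_compact hG cK) (mV x).
        + exact: measurable_set_mulgl (measurable_open oV).
        move=> z [_ /= /sV]; by rewrite invgM invgK.
      rewrite (_ : _ `&` _ = set0) ?measure0// -subset0 => z [Kz /= Vz].
      by have := KVE _ _ Kz Vz; rewrite mulgA mulgV mul1g => /mem_set; apply/negP.
  rewrite ge0_integralZl//; last first.
    by apply/measurable_EFinP; exact: measurable_indic.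
  by rewrite integral_indic// setIT muleC.
apply: mule_ereal_sup_le => //.
- by exists (mu set0), set0 => //; split => //; exact: compact0.
- exact: haar_compact hnu _ cK.
- by move=> _ [W [cW WV] <-]; exact: key.
Qed.

(* Apply [haar_cross_compact] twice, with the roles of [mu] and [nu] exchanged and
   with the same [V], so that the measures of [V] cancel. *)
Lemma haar_cross_open (mu nu : {measure set (borelType G) -> \bar R})
    (hmu : left_haar mu) (hnu : left_haar nu) (E E' : set G) :
  open E -> open E' -> mu E' < +oo -> nu E * mu E' <= mu E * nu E'.
Proof.
move=> oE oE' muE'.
have keyc K K' : compact K -> K `<=` E -> compact K' -> K' `<=` E' ->
    nu K * mu K' <= mu E * nu E'.
  move=> cK KE cK' KE'.
  have [U1 [oU1 /(_ _ erefl) U11 U1fin]] := haar_finite_open hG hmu (@compact_set1 _ 1%g).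
  have [U2 [oU2 /(_ _ erefl) U21 U2fin]] := haar_finite_open hG hnu (@compact_set1 _ 1%g).
  (* Besides the two inclusions, [V] gets finite measure for [mu] and [nu]; being open and nonempty
     it also has positive measure, so it can be cancelled. *)
  have [V [oV V1 sV VP]] : exists V : set G, [/\ open V, V 1%g, (forall x, V x -> V x^-1%g) &
     V `<=` [set v | (forall x, K x -> E (x * v)%g) /\ (forall x, K' x -> E' (x * v)%g) /\
              U1 v /\ U2 v]].
    apply: symmetric_open_nbhd; near=> v; do ! split.
    - by move=> x Kx; have [] : E (v * x)%g /\ E (x * v)%g by move: x Kx; near: v; exact: near_compact_mul.
    - by move=> x Kx; have [] : E' (v * x)%g /\ E' (x * v)%g by move: x Kx; near: v; exact: near_compact_mul.
    - by near: v; apply: open_nbhs_nbhs.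
    - by near: v; apply: open_nbhs_nbhs.
  have mV := measurable_open oV.
  have muV : mu V < +oo.
    apply: le_lt_trans U1fin; apply: measure_le => //; first exact: measurable_open.
    by move=> v /VP[_ [_ []]].
  have nuV : nu V < +oo.
    apply: le_lt_trans U2fin; apply: measure_le => //; first exact: measurable_open.
    by move=> v /VP[_ [_ []]].
  have muV0 := haar_open_gt0 hG hmu oV V1.
  have nuV0 := haar_open_gt0 hG hnu oV V1.
  have h1 : nu K * mu V <= mu E * nu V.
    by apply: haar_cross_compact => // x v Kx /VP[+ _]; exact.
  have h2 : mu K' * nu V <= nu E' * mu V.
    by apply: haar_cross_compact => // x v Kx /VP[_ [+ _]]; exact.
  move: muV0 muV nuV0 nuV h1 h2.
  case: (mu V) => [m| |]//; case: (nu V) => [n| |]//; rewrite !lte_fin => m0 _ n0 _.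
  rewrite -lee_pdivlMr// => h1; rewrite -lee_pdivlMr// => h2.
  apply: (le_trans (lee_pmul _ _ h1 h2)) => //.
  rewrite -(muleA (mu E)) -(muleA (nu E')) muleACA -!EFinM (_ : (_ * _)%R = 1%R) ?mule1//.
  by rewrite mulrA divfK ?gt_eqF// divff ?gt_eqF.
have cpt0 (mu' : {measure set (borelType G) -> \bar R}) (U : set G) :
    [set mu' W | W in [set W : set G | compact W /\ W `<=` U]] !=set0.
  by exists (mu' set0), set0 => //; split => //; exact: compact0.
rewrite muleC (haar_inner_regular hnu oE).
apply: mule_ereal_sup_le => // _ [K [cK KE] <-].
rewrite muleC (haar_inner_regular hmu oE').
apply: mule_ereal_sup_le => //; first exact: haar_compact hnu _ cK.
by move=> _ [K' [cK' KE'] <-]; exact: keyc.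
Unshelve. all: by end_near. Qed.

(** Comparison with one open set [O], of finite positive measure for both, shows that [nu] and [mu]
    are proportional on open sets; outer regularity extends this to Borel sets. *)
Lemma haar_unique (mu nu : {measure set (borelType G) -> \bar R})
    (hmu : left_haar mu) (hnu : left_haar nu) :
  exists2 c : R, (0 < c)%R &
    forall A : set (borelType G), measurable A -> nu A = c%:E * mu A.
Proof.
have [U1 [oU1 /(_ _ erefl) U11 U1fin]] := haar_finite_open hG hmu (@compact_set1 _ 1%g).
have [U2 [oU2 /(_ _ erefl) U21 U2fin]] := haar_finite_open hG hnu (@compact_set1 _ 1%g).
pose O := U1 `&` U2.
have oO : open O by exact: openI.
have muO : mu O < +oo.
  apply: le_lt_trans U1fin; apply: measure_le; last exact: subIsetl.
    exact: measurable_open.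
  exact: measurable_open.
have nuO : nu O < +oo.
  apply: le_lt_trans U2fin; apply: measure_le; last exact: subIsetr.
    exact: measurable_open.
  exact: measurable_open.
have muO0 : 0 < mu O by exact: haar_open_gt0 (conj U11 U21).
have nuO0 : 0 < nu O by exact: haar_open_gt0 (conj U11 U21).
have eqO E : open E -> nu E * mu O = mu E * nu O.
  move=> oE; apply/eqP; rewrite eq_le; apply/andP; split.
    exact: haar_cross_open.
  exact: haar_cross_open.
move: muO nuO muO0 nuO0 eqO.
case: (mu O) => [m| |]//; case: (nu O) => [n| |]//; rewrite !lte_fin => _ _ m0 n0 eqO.
exists (n / m)%R; first exact: divr_gt0.
have eqU E : open E -> nu E = (n / m)%:E * mu E.
  move=> oE; rewrite muleC EFinM muleA -eqO// -muleA -EFinM mulfV ?gt_eqF//.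
  by rewrite mule1.
move=> A mA; rewrite (haar_outer_regular hnu mA) (haar_outer_regular hmu mA).
rewrite -ereal_inf_pZl; last exact: divr_gt0.
congr ereal_inf; apply/seteqP; split => [_ [U [oU AU] <-]|_ [_ [U [oU AU] <-] <-]].
  by exists (mu U); [exists U|rewrite eqU].
by exists U => //; rewrite eqU.
Qed.

(** Right translation by [g] is a homeomorphism commuting with all left translations, so it
    preserves each defining property of a Haar measure. *)
Lemma left_haar_pushforward_mulgr (mu nu : {measure set (borelType G) -> \bar R}) (g : G) :
  left_haar mu ->
  (forall A : set (borelType G), nu A = mu [set x : G | A (x * g)%g]) ->
  left_haar nu.
Proof.
move=> hmu nuE.
have shiftK (A : set G) : [set x : G | [set y | A (y * g^-1)%g] (x * g)%g] = A.
  by apply/funext => x /=; rewrite mulgK.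
split.
- by move=> K cK; rewrite nuE; apply: haar_compact => //; exact: compact_mulgr.
- move=> A mA; rewrite nuE (haar_outer_regular hmu (measurable_set_mulgr g mA)).
  congr ereal_inf; apply/seteqP; split => _ [U [oU AU] <-].
    exists [set x | U (x * g^-1)%g]; last by rewrite nuE shiftK.
    split; first exact: open_mulgr.
    by move=> x Ax; apply: AU; rewrite /= mulgVK.
  rewrite nuE; exists [set x : G | U (x * g)%g] => //; split; first exact: open_mulgr.
  by move=> x /AU.
- move=> U oU; rewrite nuE (haar_inner_regular hmu (open_mulgr g oU)).
  congr ereal_sup; apply/seteqP; split => _ [K [cK KU] <-].
    exists [set x | K (x * g^-1)%g]; last by rewrite nuE shiftK.
    split; first exact: compact_mulgr.
    by move=> x /KU; rewrite /= mulgVK.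
  rewrite nuE; exists [set x : G | K (x * g)%g] => //; split; first exact: compact_mulgr.
  by move=> x /KU.
- move=> h A mA; rewrite !nuE image_mulgl -(haar_mulgl hmu h^-1%g _ (measurable_set_mulgr g mA)).
  by congr (mu _); apply/funext => x /=; rewrite mulgA.
- by rewrite nuE; exact: (haar_neq0 hmu).
Qed.

(** [c] is the modular factor of [g]: uniqueness is applied to the image of [mu] under right
    translation by [g]. *)
Lemma haar_modular (mu : {measure set (borelType G) -> \bar R}) (hmu : left_haar mu)
    (g : G) :
  exists2 c : R, (0 < c)%R & forall F : borelType G -> \bar R,
    measurable_fun setT F -> (forall x, 0 <= F x) ->
    \int[mu]_x F ((x : G) * g)%g = c%:E * \int[mu]_x F x.
Proof.
have mg := @measurable_mulgr G g.
pose nu : {measure set (borelType G) -> \bar R} :=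
  measure_function_pushforward__canonical__measure_function_Measure mu mg.
have [c c0 nuE] := haar_unique hmu (@left_haar_pushforward_mulgr mu nu g hmu (fun=> erefl)).
exists c => // F mF F0.
have := @ge0_integral_pushforward _ _ _ _ R _ mg mu setT F measurableT mF (fun x _ => F0 x).
rewrite preimage_setT => <-.
have c0' : (0 <= c)%R by exact: ltW.
rewrite (eq_measure_integral (mscale (NngNum c0') mu)); last by move=> A mA _; exact: nuE.
by rewrite ge0_integral_mscale.
Qed.

Lemma haar_integral_mulgl (mu : {measure set (borelType G) -> \bar R}) (hmu : left_haar mu)
    (g : G) (F : borelType G -> \bar R) :
  measurable_fun setT F -> (forall x, 0 <= F x) ->
  \int[mu]_x F (g * (x : G))%g = \int[mu]_x F x.
Proof.
move=> mF F0.
have mg := @measurable_mulgl G g.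
have := @ge0_integral_pushforward _ _ _ _ R _ mg mu setT F measurableT mF (fun x _ => F0 x).
rewrite preimage_setT => <-.
by apply: eq_measure_integral => A mA _; exact: (haar_mulgl hmu g A mA).
Qed.
End haar_unique.

(** * Continuity of translations in L^p *)

Import HBSimple.

Section translation_continuity.
Context (R : realType) (G : topologicalGroupType) (hG : hausdorff_space G).
Context (mu : {measure set (borelType G) -> \bar R}) (hmu : left_haar mu).
Local Open Scope ereal_scope.

Lemma near_invg (P : set G) :
  (\forall u \near (1%g : G), P u) -> \forall u \near (1%g : G), P u^-1%g.
Proof.
by move=> P1; have := @invg_continuous G 1%g P; rewrite invg1; exact.
Qed.

(** Regularity gives an open [U] containing [A] and a compact [K] in [U], with [U] minus [A] and [U]
    minus [K] both of measure at most [e / 2]; [K] need not lie in [A]. If [u^-1 K] stays in [U], a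
    point [x] outside [A] with [u x] in [A] either lies in [U] minus [A] or is sent by [u] into [U]
    minus [K]. *)
Lemma haar_near_setD (A : set (borelType G)) (e : R) :
  measurable A -> mu A < +oo -> (0 < e)%R ->
  \forall u \near (1%g : G), mu ([set x : G | A (u * x)%g] `\` A) <= e%:E.
Proof.
move=> mA Afin e0.
have e20 : (0 < e / 2)%R by exact: divr_gt0.
have muA : mu A \is a fin_num by rewrite ge0_fin_numE.
have : mu A < mu A + (e / 2)%:E by rewrite lteDl.
rewrite {1}(haar_outer_regular hmu mA) => /ereal_inf_lt[_ [U [oU AU] <-] muU].
have mU := measurable_open oU.
have Ufin : mu U < +oo.
  by apply: lt_trans muU _; rewrite lte_add_pinfty// ltry.
have muUf : mu U \is a fin_num by rewrite ge0_fin_numE.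
have : mu U - (e / 2)%:E < mu U by rewrite lteBlDr// lteDl.
rewrite {2}(haar_inner_regular hmu oU) => /ereal_sup_gt[_ [K [cK KU] <-] muK].
have mK := measurable_compact hG cK.
near=> u.
have Ku : forall x, K x -> U (u^-1 * x)%g.
  near: u; apply: (@near_invg (fun u => forall x, K x -> U (u * x)%g)).
  by apply: filterS (near_compact_mul cK oU KU) => u uK x /uK[].
have mUK : measurable ((U : set (borelType G)) `\` K) by exact: measurableD.
apply: (@le_trans _ _ (mu ([set x : G | ((U : set (borelType G)) `\` K) (u * x)%g] `|` (U `\` A)))).
  apply: measure_le.
  - by apply: measurableD => //; exact: measurable_set_mulgl.
  - by apply: measurableU; [exact: measurable_set_mulgl|exact: measurableD].
  move=> x [/= Aux nAx]; have [Ux|nUx] := pselect (U x); [right|left] => //.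
  split; first exact: AU.
  by move=> /Ku; rewrite mulKg.
apply: (le_trans (measureU2 _ _ _)); [exact: measurable_set_mulgl|exact: measurableD|].
rewrite [X in X + _](haar_mulgl hmu u _ mUK) (splitr e) EFinD leeD//.
  rewrite measureD//.
  rewrite (setIidr KU) leeBlDr ?ge0_fin_numE//; last exact: haar_compact hmu _ cK.
  by rewrite addeC -leeBlDr//; exact: ltW.
rewrite measureD//.
by rewrite (setIidr AU) leeBlDr// addeC; exact: ltW.
Unshelve. all: by end_near. Qed.

Lemma measurable_fun_mulgl (u : G) (f : borelType G -> R) : measurable_fun setT f ->
  measurable_fun setT (fun x : borelType G => f (u * (x : G))%g).
Proof. by move=> mf; apply: (measurableT_comp mf); exact: measurable_mulgl. Qed.

Lemma measurable_fun_mulgl_sub (u : G) (f : borelType G -> R) : measurable_fun setT f ->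
  measurable_fun setT (fun x : borelType G => f (u * (x : G))%g - f x)%R.
Proof. by move=> mf; apply: measurable_funB => //; exact: measurable_fun_mulgl. Qed.

Lemma Lnorm_mulgl p (u : G) (f : borelType G -> R) : measurable_fun setT f ->
  'N[mu]_p%:E[EFin \o (fun x : borelType G => f (u * (x : G))%g)] =
  'N[mu]_p%:E[EFin \o f].
Proof.
move=> mf; rewrite unlock /Lnorm; congr (_ `^ _).
apply: (@haar_integral_mulgl _ _ mu hmu u (fun x => (`|f x| `^ p)%:E)) => //.
apply/measurable_EFinP; apply: (@measurableT_comp _ _ _ _ _ _ (fun x : R => x `^ p)%R) => //.
exact: measurableT_comp.
Qed.

Definition shift_continuous (f : borelType G -> R) := forall e : R, (0 < e)%R ->
  \forall u \near (1%g : G),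
    'N[mu]_1[EFin \o (fun x : borelType G => f (u * (x : G))%g - f x)%R] <= e%:E.

(** The norm is the measure of a symmetric difference: [haar_near_setD] at [u] bounds one half and,
    after a translation, at [u^-1] the other. *)
Lemma shift_continuous_indic (A : set (borelType G)) :
  measurable A -> mu A < +oo -> shift_continuous \1_A.
Proof.
move=> mA Afin e e0.
have e20 : (0 < e / 2)%R by exact: divr_gt0.
have near1 := haar_near_setD mA Afin e20.
apply: filterS2 near1 (near_invg near1) => u BA AB'.
pose B : set (borelType G) := [set x : G | A (u * x)%g].
have mB : measurable B by exact: measurable_set_mulgl.
have mBA : measurable (B `\` A) by exact: measurableD.
have mAB : measurable (A `\` B) by exact: measurableD.
have AB : mu (A `\` B) <= (e / 2)%:E.
  rewrite -(haar_mulgl hmu u^-1%g _ mAB).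
  rewrite (_ : [set x | _] = [set x : G | A (u^-1 * x)%g] `\` A)//.
  by apply/funext => x; rewrite /B /setD/= mulgA mulgV mul1g.
rewrite Lnorm1 (splitr e) EFinD; apply: le_trans (leeD BA AB).
rewrite -[X in _ <= mu X + _]setIT -[X in _ <= _ + mu X]setIT -!integral_indic//.
rewrite -ge0_integralD//; last 2 first.
- by apply/measurable_EFinP; exact: measurable_indic.
- by apply/measurable_EFinP; exact: measurable_indic.
rewrite le_eqVlt; apply/orP; left; apply/eqP; apply: eq_integral => x _ /=.
rewrite -EFinD !indicE; congr EFin.
rewrite !in_setD (_ : (x \in B) = ((u * (x : G))%g \in A)); last first.
  by apply/idP/idP; rewrite !inE.
case: (_ \in A); case: (_ \in A) => /=;
  by rewrite ?subrr ?subr0 ?sub0r ?normrN ?normr0 ?normr1 ?addr0 ?add0r.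
Qed.

Lemma shift_continuousD (f g : borelType G -> R) :
  measurable_fun setT f -> measurable_fun setT g ->
  shift_continuous f -> shift_continuous g -> shift_continuous (f \+ g)%R.
Proof.
move=> mf mg cf cg e e0.
have e20 : (0 < e / 2)%R by exact: divr_gt0.
apply: filterS2 (cf _ e20) (cg _ e20) => u fu gu.
rewrite (splitr e) EFinD; apply: le_trans (leeD fu gu).
apply: le_trans (minkowski_EFin _ _ _ _) => //; try exact: measurable_fun_mulgl_sub.
rewrite le_eqVlt; apply/orP; left; apply/eqP; congr Lnorm.
by apply/funext => x /=; congr EFin; lra.
Qed.

Lemma shift_continuousZ (r : R) (f : borelType G -> R) :
  measurable_fun setT f -> shift_continuous f -> shift_continuous (fun x => r * f x)%R.
Proof.
move=> mf cf e e0.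
have r1 : (0 < `|r| + 1)%R by rewrite ltr_wpDl.
have : (0 < e / (`|r| + 1))%R by exact: divr_gt0.
move=> /cf; apply: filterS => u.
rewrite !Lnorm1 => fu.
under eq_integral do rewrite /= -mulrBr normrM EFinM.
rewrite ge0_integralZl//; last first.
  by do 2 apply: measurableT_comp => //; exact: measurable_fun_mulgl_sub.
apply: (le_trans (lee_wpmul2l _ fu)) => //.
rewrite -EFinM lee_fin mulrCA ler_piMr// ?(ltW e0)// ler_pdivrMr// mul1r.
by rewrite lerDl.
Qed.

Lemma shift_continuous_approx (f : borelType G -> R) : measurable_fun setT f ->
  (forall e : R, (0 < e)%R -> exists g : borelType G -> R, [/\ measurable_fun setT g,
    shift_continuous g & 'N[mu]_1[EFin \o (f \- g)%R] <= e%:E]) ->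
  shift_continuous f.
Proof.
move=> mf H e e0.
have e20 : (0 < e / 2)%R by exact: divr_gt0.
(* Passing from [f] to [g] is paid twice, once at [u x] and once at [x], hence a quarter of [e]. *)
have e40 : (0 < e / 2 / 2)%R by exact: divr_gt0.
have [g [mg cg fg]] := H _ e40.
have mh : measurable_fun setT (f \- g)%R by exact: measurable_funB.
apply: filterS (cg _ e20) => u gu.
pose k (x : borelType G) := ((f \- g)%R (u * (x : G))%g - (f \- g)%R x)%R.
have kE : 'N[mu]_1[EFin \o k] <= (e / 2)%:E.
  rewrite (splitr (e / 2)) EFinD.
  apply: (le_trans (@eminkowski _ _ _ mu (fun x : borelType G => (f \- g)%R (u * (x : G))%g)
    (fun x => - (f \- g) x)%R 1 _ _ _)) => //.
  - exact: measurable_fun_mulgl.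
  - exact: measurableT_comp.
  rewrite leeD//; first by rewrite Lnorm_mulgl.
  rewrite (_ : EFin \o _ = \- (EFin \o (f \- g)%R)) ?oppe_Lnorm//.
rewrite (splitr e) EFinD; apply: le_trans (leeD kE gu).
apply: le_trans (minkowski_EFin _ _ _ _) => //; try exact: measurable_fun_mulgl_sub.
rewrite le_eqVlt; apply/orP; left; apply/eqP; congr Lnorm.
by apply/funext => x /=; congr EFin; rewrite /k/=; lra.
Qed.

Lemma shift_continuous_L1 (f : borelType G -> R) :
  mu.-integrable setT (EFin \o f) -> shift_continuous f.
Proof.
move=> intf; have /measurable_EFinP mf := measurable_int _ intf.
apply: shift_continuous_approx => // e e0.
have [g_ [intg _ /fine_cvgP[gfin]]] := approximation_sfun_integrable measurableT intf.
move=> /cvgrPdist_lt/(_ _ e0) ge; near \oo => N.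
have fN : \int[mu]_z `|(EFin \o f) z - (g_ N z)%:E| \is a fin_num by near: N.
have gN : (`|0 - fine (\int[mu]_z `|(EFin \o f) z - (g_ N z)%:E|)| < e)%R by near: N.
exists (g_ N); split => //; last first.
  rewrite Lnorm1 -[leLHS]fineK//; apply/ltW; move: gN.
  by rewrite sub0r normrN lte_fin; apply: le_lt_trans; exact: ler_norm.
(* The simple function is a finite sum of multiples of indicators of its level sets. Those of
   nonzero values have finite measure, by a Markov-type bound; that of [0] may not, but its term is
   zero. *)
pose F (y : R) (x : borelType G) : R := (y * \1_((g_ N) @^-1` [set y]) x)%R.
have -> : (g_ N : _ -> _) =
    (fun x => \sum_(y <- finmap.enum_fset (fset_set (range (g_ N)))) F y x)%R.
  by apply/funext => x; rewrite [LHS]fimfunE fsbig_finite.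
have mr r : measurable (g_ N @^-1` [set r]).
  by rewrite -[X in measurable X]setTI; exact: measurable_funPT.
have fin r : r != 0%R -> mu (g_ N @^-1` [set r]) < +oo.
  move=> r0; have /integrableP[_] := intg N.
  have r0' : (0 < `|r|)%R by rewrite normr_gt0.
  apply: contraTT; rewrite -!leNgt => /(lee_wpmul2l (ltW (r0' : 0 < `|r|%:E))).
  rewrite gt0_muley ?lte_fin// => /le_trans; apply.
  rewrite -[X in mu X]setIT -integral_indic// -ge0_integralZl//; last first.
    by apply/measurable_EFinP; exact: measurable_indic.
  apply: ge0_le_integral => //.
  - by apply: measurable_funeM; apply/measurable_EFinP; exact: measurable_indic.
  - by apply: measurableT_comp => //; case/integrableP: (intg N).
  - move=> x _ /=; rewrite -EFinM lee_fin indicE.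
    by have [|] := boolP (x \in _); rewrite ?mulr0// mulr1 inE /= => ->.
have mF y : measurable_fun setT (F y).
  by apply: measurable_funM => //; exact: measurable_indic.
have shift0 : shift_continuous (cst 0%R).
  move=> d d0; apply: nearW => u; rewrite Lnorm1.
  by under eq_integral do rewrite /= subrr normr0; rewrite integral0 lee_fin ltW.
elim: (finmap.enum_fset (fset_set (range (g_ N)))) => [|y s IH].
  rewrite (_ : (fun x => _) = cst 0%R)//.
  by apply/funext => x; rewrite big_nil.
rewrite (_ : (fun x => _) = F y \+ (fun x => \sum_(z <- s) F z x))%R; last first.
  by apply/funext => x; rewrite big_cons.
apply: shift_continuousD IH => //; first exact: measurable_sum.
have [->|y0] := eqVneq y 0%R.
  rewrite (_ : F _ = cst 0%R)//.
  by apply/funext => x; rewrite /F mul0r.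
apply: shift_continuousZ; first exact: measurable_indic.
by apply: shift_continuous_indic => //; exact: fin.
Unshelve. all: by end_near. Qed.

End translation_continuity.

(** * Power inequalities and [L^p] norms *)

Lemma powR_superadd (R : realType) (a b p : R) : 0 <= b -> b <= a -> 1 <= p ->
  (a - b) `^ p <= a `^ p - b `^ p.
Proof.
move=> b0 ba p1.
have p0 : p != 0 by rewrite gt_eqF// (lt_le_trans _ p1).
have [->|b1] := eqVneq b 0; first by rewrite powR0// !subr0.
have {b1}b0 : 0 < b by rewrite lt_def b1.
have a0 : 0 < a by exact: lt_le_trans ba.
have [->|ab] := eqVneq a b; first by rewrite !subrr powR0.
have {ba}ba : b < a by rewrite lt_def ab ltW// lt_def ab.
rewrite lerBrDr.
(* For [0 < c <= a] one has [(c/a)^p <= c/a]; the instances [c = a - b] and [c = b] add up to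
   [a^p]. *)
have h c : 0 < c <= a -> c `^ p <= c / a * a `^ p.
  move=> /andP[c0 ca]; rewrite -[X in X `^ _](divfK (lt0r_neq0 a0) c).
  by apply: ge1r_powRZ => //; [rewrite divr_gt0// ler_pdivrMr// mul1r|exact: ltW].
apply: (le_trans (lerD (h _ _) (h _ _))).
- by rewrite subr_gt0 ba lerBlDr lerDl ltW.
- by rewrite b0 ltW.
by rewrite -mulrDl -mulrDl subrK divff ?mul1r// gt_eqF.
Qed.

Section lnorm_tools.
Context d (T : measurableType d) (R : realType).
Variable mu : {measure set T -> \bar R}.
Local Open Scope ereal_scope.

Lemma lee_poweR (x y : \bar R) (r : R) : (0 <= r)%R -> 0 <= x -> x <= y ->
  x `^ r <= y `^ r.
Proof.
move=> r0 x0 xy; apply: gt0_ler_poweR => //; rewrite in_itv/= ?x0 ?leey//.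
by rewrite (le_trans x0 xy).
Qed.

(** The integral is a supremum over simple functions below the integrand, so monotonicity also
    covers the gradient, which may fail to be measurable. *)
Lemma ge0_integral_le (f g : T -> \bar R) : (forall x, 0 <= f x) ->
  (forall x, f x <= g x) -> \int[mu]_x f x <= \int[mu]_x g x.
Proof.
move=> f0 fg; have g0 x : 0 <= g x by exact: le_trans (fg x).
rewrite !ge0_integralTE//; apply: le_ereal_sup => _ [h hf <-].
by exists h => // x; exact: le_trans (hf x) (fg x).
Qed.

Lemma Lnorm_powE (p : R) (f : T -> R) : (0 < p)%R ->
  'N[mu]_p%:E[EFin \o f] `^ p = \int[mu]_x (`|f x| `^ p)%:E.
Proof. by move=> p0; rewrite poweR_Lnorm ?gt_eqF. Qed.

Lemma Lnorm_lefin (p c : R) (f : T -> R) : (0 < p)%R -> (0 <= c)%R ->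
  \int[mu]_x (`|f x| `^ p)%:E <= (c `^ p)%:E -> 'N[mu]_p%:E[EFin \o f] <= c%:E.
Proof.
move=> p0 c0 fc; rewrite unlock /Lnorm.
rewrite -[c in leRHS](_ : (c `^ p) `^ p^-1 = c)%R; last first.
  by rewrite -powRrM mulfV ?gt_eqF// powRr1.
rewrite -poweR_EFin; apply: lee_poweR => //; first by rewrite invr_ge0 ltW.
by apply: integral_ge0 => x _; exact: poweR_ge0.
Qed.

Lemma le_Lnorm (p : R) (f g : T -> \bar R) : (0 < p)%R ->
  (forall x, `|f x| <= `|g x|) -> 'N[mu]_p%:E[f] <= 'N[mu]_p%:E[g].
Proof.
move=> p0 fg; rewrite unlock /Lnorm; apply: lee_poweR.
- by rewrite invr_ge0 ltW.
- by apply: integral_ge0 => x _; exact: poweR_ge0.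
apply: ge0_integral_le => x; first exact: poweR_ge0.
by apply: lee_poweR => //; exact: ltW.
Qed.

Lemma measurable_fun_normrpowR (p : R) (f : T -> R) : measurable_fun setT f ->
  measurable_fun setT (fun x => (`|f x| `^ p)%:E).
Proof.
move=> mf; apply/measurable_EFinP.
by apply: (@measurableT_comp _ _ _ _ _ _ (fun x : R => x `^ p)%R) => //; exact: measurableT_comp.
Qed.

Lemma finite_norm_integral (p : R) (f : T -> R) : (0 < p)%R ->
  'N[mu]_p%:E[EFin \o f] < +oo -> \int[mu]_x (`|f x| `^ p)%:E < +oo.
Proof. by move=> p0 fN; rewrite -Lnorm_powE// poweR_lty. Qed.

Lemma LnormZ_real (p c : R) (f : T -> R) : (0 < p)%R -> measurable_fun setT f ->
  'N[mu]_p%:E[EFin \o (fun x => c * f x)%R] = `|c|%:E * 'N[mu]_p%:E[EFin \o f].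
Proof.
move=> p0 mf; rewrite unlock /Lnorm.
under eq_integral do rewrite /= normrM powRM// EFinM.
rewrite ge0_integralZl//; last exact: measurable_fun_normrpowR.
rewrite poweRM ?lee_fin ?powR_ge0//; last first.
  by apply: integral_ge0 => x _; rewrite lee_fin powR_ge0.
by rewrite poweR_EFin -powRrM mulfV ?gt_eqF// powRr1.
Qed.

End lnorm_tools.

Lemma powR_distr (R : realType) (a b p : R) : 0 <= a -> 0 <= b -> 1 <= p ->
  `|a - b| `^ p <= `|a `^ p - b `^ p|.
Proof.
move=> a0 b0 p1; wlog ba : a b a0 b0 / b <= a => [H|].
  have [/H|/ltW/H] := leP b a; first exact.
  by rewrite (distrC b) (distrC (b `^ p)); exact.
rewrite ger0_norm ?subr_ge0//; apply: le_trans (ler_norm _).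
exact: powR_superadd.
Qed.

Section shift_continuous_Lp.
Context (R : realType) (G : topologicalGroupType) (hG : hausdorff_space G).
Context (mu : {measure set (borelType G) -> \bar R}) (hmu : left_haar mu).
Local Open Scope ereal_scope.

(** By [powR_distr] the [p]-th power of the [L^p] increment is at most the [L^1] increment of [f^p],
    which is integrable. *)
Lemma shift_continuous_Lp (p : R) (f : borelType G -> R) (e : R) :
  (1 <= p)%R -> measurable_fun setT f -> (forall x, 0 <= f x)%R ->
  'N[mu]_p%:E[EFin \o f] < +oo -> (0 < e)%R ->
  \forall u \near (1%g : G),
    'N[mu]_p%:E[EFin \o (fun x : borelType G => f (u * (x : G))%g - f x)%R] <= e%:E.
Proof.
move=> p1 mf f0 fN e0.
have p0 : (0 < p)%R by exact: lt_le_trans p1.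
have mfp := measurable_fun_normrpowR p mf.
have intf : mu.-integrable setT (EFin \o (fun x => `|f x| `^ p)%R).
  apply/integrableP; split => //.
  under eq_integral do rewrite gee0_abs ?lee_fin ?powR_ge0//.
  exact: finite_norm_integral.
have ep : (0 < e `^ p)%R by exact: powR_gt0.
apply: filterS (shift_continuous_L1 hG hmu intf ep) => u; rewrite Lnorm1 => fu.
apply: Lnorm_lefin => //; first exact: ltW.
apply: le_trans fu; apply: ge0_integral_le => x; first by rewrite lee_fin powR_ge0.
rewrite /= lee_fin !(ger0_norm (f0 _)); exact: powR_distr.
Qed.

End shift_continuous_Lp.

(** * Balls for the word length *)

Section words.
Context (G : groupType) (S : set G).
Implicit Types (g h : G) (m n : nat).

(** Integer radii keep word lengths out of the extended reals; [word_ball_nat] identifies these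
    balls with the word balls. *)
Definition nat_ball n : set G :=
  [set g | exists2 m, (m <= n)%N & set_expg S m g].

Lemma set_expgD m n g h :
  set_expg S m g -> set_expg S n h -> set_expg S (m + n) (g * h)%g.
Proof.
elim: m g => [g /= ->|m IH _ /= [s Ss [x Sx <-]] Sh]; first by rewrite mul1g.
by exists s => //; exists (x * h)%g; [exact: IH|rewrite mulgA].
Qed.

Lemma set_expg1 g : S g -> set_expg S 1 g.
Proof. by move=> Sg; exists g => //; exists 1%g => //; rewrite mulg1. Qed.

Lemma set_expgV n g : symmetric_set S -> set_expg S n g -> set_expg S n g^-1%g.
Proof.
move=> sS; elim: n g => [g /= ->|n IH _ [s Ss [x Sx <-]]]; first by rewrite invg1.
by rewrite invgM -addn1; apply: set_expgD; [exact: IH|apply: set_expg1; exact: sS].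
Qed.

Lemma nat_ballM m n g h : nat_ball m g -> nat_ball n h -> nat_ball (m + n) (g * h)%g.
Proof.
move=> [i im Sg] [j jn Sh]; exists (i + j)%N; first exact: leq_add.
exact: set_expgD.
Qed.

Lemma nat_ballV n g : symmetric_set S -> nat_ball n g -> nat_ball n g^-1%g.
Proof. by move=> sS [i im Sg]; exists i => //; exact: set_expgV. Qed.

Lemma nat_ball_le m n g : (m <= n)%N -> nat_ball m g -> nat_ball n g.
Proof. by move=> mn [i im Sg]; exists i => //; exact: leq_trans mn. Qed.

Lemma nat_ball1 n : nat_ball n 1%g.
Proof. by exists 0%N. Qed.

Lemma nat_ball_sub g : S g -> nat_ball 1 g.
Proof. by move=> Sg; exists 1%N => //; exact: set_expg1. Qed.

Variable R : realType.

Lemma word_ball_nat n g : word_ball S (n%:R : R) g <-> nat_ball n g.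
Proof.
split; last first.
  move=> [m mn Sg]; apply: (@le_trans _ _ (m%:R)%:E); last by rewrite lee_fin ler_nat.
  by apply: ereal_inf_lbound; exists m.
(* Integrality replaces attainment of the infimum: a length below [n + 1] is at most [n]. *)
move=> gn; have : (word_length R S g < (n.+1%:R)%:E)%E.
  by apply: le_lt_trans gn _; rewrite lte_fin ltr_nat.
move=> /ereal_inf_lt[_ [m Sg <-]]; rewrite lte_fin ltr_nat ltnS => mn.
by exists m.
Qed.

Hypothesis genS : generating_set S.

Lemma generating_nat_ball g : exists n, nat_ball n g.
Proof.
have : [set: G] g by [].
by rewrite -genS => -[n _ Sg]; exists n, n.
Qed.

Lemma word_lengthP g : exists n, [/\ word_length R S g = (n%:R)%:E, nat_ball n g &
  forall m, nat_ball m g -> (n <= m)%N].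
Proof.
have [n Hn] := generating_nat_ball g.
have ex : exists n, `[< nat_ball n g >] by exists n; exact/asboolP.
case: (ex_minnP ex) => m /asboolP gm mmin; exists m; split => //; last first.
  by move=> k gk; apply: mmin; exact/asboolP.
apply/eqP; rewrite eq_le; apply/andP; split; first by have /word_ball_nat := gm.
apply: le_ereal_inf_tmp => _ [k Sg <-]; rewrite lee_fin ler_nat.
by apply: mmin; apply/asboolP; exists k.
Qed.

(** If no element had length exactly [n], the ball of radius [n] would equal the one of radius
    [n - 1]; the latter would be stable under multiplication by [S], hence the whole group. *)
Lemma nat_ball_exact n : (exists g, ~ nat_ball n g) ->
  exists2 g, nat_ball n g & forall m, nat_ball m g -> (n <= m)%N.
Proof.
move=> [g0 ng0]; apply: contrapT => /forall2NP nex.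
have step g : nat_ball n g -> exists2 m, (m < n)%N & nat_ball m g.
  move=> gn; have [//|/existsNP[m /not_implyP[gm /negP]]] := nex g.
  by rewrite -ltnNge => mn; exists m.
case: n => [|n] in ng0 nex step *.
  by have [m] := step 1%g (nat_ball1 0).
have mulS s g : S s -> nat_ball n g -> nat_ball n (s * g)%g.
  move=> Ss gn; have [|m mn] := step (s * g)%g; last by apply: nat_ball_le.
  exact: nat_ballM (nat_ball_sub Ss) gn.
have [k Sg] : exists k, set_expg S k g0.
  by have [k [m _ Sg]] := generating_nat_ball g0; exists m.
apply: ng0; apply: (@nat_ball_le n) => //.
elim: k g0 Sg => [_ /= ->|k IH _ [s Ss [x Sx <-]]]; first exact: nat_ball1.
by apply: mulS => //; exact: IH.
Qed.

End words.

Section compact_ball.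
Context (G : topologicalGroupType) (S : set G) (cS : compact S).

Context (R : realType) (hG : hausdorff_space G) (sS : symmetric_set S)
  (genS : generating_set S).
Context (mu : {measure set (borelType G) -> \bar R}) (hmu : left_haar mu).
Local Open Scope ereal_scope.

(* Steinhaus: a compact set [A] of positive measure meets [v A] for [v] close
   to [1], so that [A A^-1] is a neighbourhood of [1]. *)
Lemma nat_ball_nbhs1 : exists n, nbhs (1%g : G) (nat_ball S n).
Proof.
have [n mun] : exists n, mu (set_expg S n) != 0.
  apply: contrapT => /forallNP H; have /negP := haar_neq0 hmu; apply.
  apply/eqP; apply: measure_negligible; first exact: measurableT.
  rewrite -[[set: _]]genS; apply: negligible_bigcup => n; apply/negligibleP.
    by apply: measurable_compact => //; exact: compact_set_expg.
  by move/negP/negPn/eqP : (H n).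
pose A := set_expg S n.
have cA : compact A by exact: compact_set_expg.
have mA := measurable_compact hG cA.
have A0 : 0 < mu A by rewrite lt0e mun measure_ge0.
have Afin := haar_compact hmu cA.
have : mu A < mu A + mu A by rewrite lteDl// ge0_fin_numE.
rewrite {1}(haar_outer_regular hmu mA) => /ereal_inf_lt[_ [U [oU AU] <-] muU].
exists (n + n)%N; apply: filterS (near_compact_mul cA oU AU) => v vA.
have [[x [Ax Avx]]|disj] := pselect (exists x, A x /\ A (v^-1 * x)%g).
  rewrite (_ : v = (x * (v^-1 * x)^-1)%g); last by rewrite invgM invgK mulgA mulgV mul1g.
  by apply: nat_ballM; [|apply: nat_ballV => //]; exists n.
exfalso; move: muU; apply/negP; rewrite -leNgt.
pose vA' : set (borelType G) := [set x : G | A (v^-1 * x)%g].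
have mvA : measurable vA' by exact: measurable_set_mulgl.
rewrite -{1}(haar_mulgl hmu v^-1%g _ mA) -measureU//.
- apply: measure_le; [exact: measurableU|exact: measurable_open|].
  move=> x [/vA[]|/AU//]; by rewrite mulgA mulgV mul1g.
- by rewrite -subset0 => x [vx Ax]; apply: disj; exists x.
Qed.

End compact_ball.

(** * Almost optimal functions at dyadic scales *)

Section ereal_tools.
Context (R : realType).
Local Open Scope ereal_scope.

Lemma lee_pinv (x y : \bar R) : 0 <= x -> x <= y -> y^-1 <= x^-1.
Proof.
case: x => [x| |]//; case: y => [y| |]//.
- rewrite !lee_fin !inver => x0 xy; case: (eqVneq x 0%R) => [_|xn0]; first exact: leey.
  have {}x0 : (0 < x)%R by rewrite lt_def xn0.
  have y0 : (0 < y)%R by exact: lt_le_trans xy.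
  by rewrite gt_eqF// lee_fin lef_pV2.
- by rewrite invey inve_ge0.
Qed.

Lemma nneseries_le_disjoint (u : (\bar R)^nat) (c : \bar R) :
  (forall k, 0 <= u k) -> (forall k, u k <= c) ->
  (forall j k, u j != 0 -> u k != 0 -> j = k) ->
  \sum_(k <oo) u k <= c.
Proof.
move=> u0 uc udisj; apply: lime_le; first exact: is_cvg_nneseries.
apply: nearW => n; rewrite big_mkord.
have c0 : 0 <= c by exact: le_trans (uc 0%N).
elim: n => [|n IH]; first by rewrite big_ord0.
rewrite big_ord_recr/=.
have [->|un] := eqVneq (u n) 0; first by rewrite adde0.
rewrite big1 ?add0e// => i _; apply/eqP/negPn/negP => ui.
by have := udisj _ _ ui un; have := ltn_ord i; lia.
Qed.

End ereal_tools.

Section dyadic.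
Context (R : realType) (p : R) (p1 : 1 < p).
Context (f : R -> R) (f_ge0 : forall t, 0 <= t -> 0 <= f t)
  (f_nd : forall s t, 0 <= s -> s <= t -> f s <= f t).
Context (J : R -> \bar R) (J_ge0 : forall t, (0 <= J t)%E)
  (J_nd : forall s t, s <= t -> (J s <= J t)%E).
Local Open Scope ereal_scope.

Let pow2_gt0 k : (0 < 2 ^+ k :> R)%R. Proof. exact: exprn_gt0. Qed.

Let a k := (f (2 ^+ k))%:E / J (2 ^+ k.+1).
Let I k : set R := `[(2 ^+ k : R)%R, (2 ^+ k.+1)%R [%classic.

(** On [[2^k, 2^(k+1)[] monotonicity bounds the integrand below by [a k ^ p / 2^(k+1)], with [f]
    taken at the left end and the profile at the right end. The interval has length [2^k], so it
    contributes at least half of [a k ^ p]. *)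
Lemma dyadic_sum : \int[lebesgue_measure]_(t in `[1%R, +oo[)
    (((f t)%:E / J t) `^ p * (t^-1)%:E) < +oo ->
  \sum_(k <oo) (a k) `^ p < +oo.
Proof.
have a0 k : 0 <= a k.
  by rewrite mule_ge0 ?inve_ge0// lee_fin f_ge0// ltW.
pose F t := ((f t)%:E / J t) `^ p * (t^-1)%:E.
pose h k (t : R) : \bar R := (a k `^ p * (((2 ^+ k.+1)^-1)%R : R)%:E) * (\1_(I k) t)%:E.
have h0 k t : 0 <= h k t.
  by rewrite !mule_ge0 ?poweR_ge0// ?lee_fin ?indic_ge0// invr_ge0 ltW.
have mI k : measurable (I k) by exact: measurable_itv.
have mind k : measurable_fun setT (fun t => (\1_(I k) t : R)%:E).
  by apply/measurable_EFinP; exact: measurable_indic.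
have mh k : measurable_fun setT (h k) by exact: measurable_funeM.
have hF k t : I k t -> h k t <= F t.
  rewrite /I /= in_itv/= => /andP[kt tk].
  have t0 : (0 < t)%R by exact: lt_le_trans kt.
  rewrite /h indicE mem_set ?mule1; last by rewrite /I/= in_itv/= kt tk.
  apply: lee_pmul; rewrite ?poweR_ge0 ?lee_fin ?invr_ge0 ?(ltW (pow2_gt0 _))//.
    apply: lee_poweR => //; first by rewrite (le_trans ler01)// ltW.
    apply: lee_pmul; rewrite ?inve_ge0 ?lee_fin ?f_ge0 ?(ltW (pow2_gt0 _))//.
      by apply: f_nd => //; exact: ltW.
    by apply: lee_pinv => //; apply: J_nd; exact: ltW.
  by rewrite lef_pV2 ?posrE// ltW.
move=> Fint.
have : \int[lebesgue_measure]_t (\sum_(k <oo) h k t) < +oo.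
  apply: le_lt_trans Fint; rewrite [leRHS]integral_mkcond.
  apply: ge0_integral_le => t; first by apply: nneseries_ge0 => *; exact: h0.
  have F0 : 0 <= (F \_ `[1%R, +oo[) t.
    rewrite patchE; case: ifPn => //; rewrite inE /= in_itv/= andbT => t1.
    by rewrite mule_ge0 ?poweR_ge0// lee_fin invr_ge0 (le_trans ler01).
  have hI k : h k t != 0 -> I k t.
    by apply: contra_neqP => It; rewrite /h indicE memNset// mule0.
  apply: nneseries_le_disjoint => //.
    move=> k; have [->//|/hI It] := eqVneq (h k t) 0.
    apply: (le_trans (hF _ _ It)); rewrite patchE mem_set//=.
    move: It; rewrite /I/= !in_itv/= => /andP[kt _]; rewrite andbT (le_trans _ kt)//.
    by rewrite exprn_ege1// ler1n.
  move=> j k /hI + /hI; rewrite /I/= !in_itv/= => /andP[jt tj] /andP[kt tk].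
  have : (2 ^+ j < 2 ^+ k.+1 :> R)%R by exact: le_lt_trans tk.
  have : (2 ^+ k < 2 ^+ j.+1 :> R)%R by exact: le_lt_trans tj.
  by rewrite !ltr_eXn2l ?ltr1n//; lia.
rewrite integral_nneseries//.
have hint k : \int[lebesgue_measure]_t h k t = (2^-1)%:E * a k `^ p.
  rewrite ge0_integralZl//; last 2 first.
    exact: mind.
    by rewrite mule_ge0 ?poweR_ge0// lee_fin invr_ge0 ltW.
  rewrite integral_indic//; last exact: mI.
  rewrite setIT [X in _ * X](@lebesgue_measure_itv R `[(2 ^+ k)%R, (2 ^+ k.+1)%R[)/= lte_fin ltr_eXn2l ?ltr1n// leqnn.
  rewrite -EFinB -muleA -EFinM muleC; congr (_%:E * _).
  by rewrite exprS; move: (pow2_gt0 k) => ? /=; field; rewrite gt_eqF.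
under eq_eseriesr do rewrite hint.
rewrite nneseriesZl; last by move=> *; exact: poweR_ge0.
by apply: contraTT; rewrite -!leNgt !leye_eq => /eqP ->; rewrite gt0_muley ?lte_fin.
Qed.

End dyadic.

Section near_optimal.
Context (R : realType) (G : topologicalGroupType).
Context (mu : {measure set (borelType G) -> \bar R}) (S : set G) (p : R) (p1 : 1 < p).
Local Open Scope ereal_scope.
Local Notation J := (isoperimetric_profile mu S p).
Local Notation "'Np[ f ]" := ('N[mu]_p%:E[EFin \o f]) (format "''Np[' f ]").

Let p0 : (0 < p)%R. Proof. exact: lt_trans p1. Qed.

Lemma isoperimetric_profile_ge0 t : 0 <= J t.
Proof. by rewrite le_max lexx. Qed.

Lemma le_isoperimetric_profile s t : (s <= t)%R -> J s <= J t.
Proof.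
move=> st; rewrite ge_max isoperimetric_profile_ge0/= le_max; apply/orP; right.
apply: le_ereal_sup => _ [phi [Lphi phi0 supp] <-]; exists phi => //; split => //.
by apply: subset_trans supp _ => g /le_trans; apply; rewrite lee_fin.
Qed.

(* Increments are bounded one [s] at a time, because the gradient, a supremum
   over [S], need not be measurable. *)
Definition slowly_varying (psi : borelType G -> R) (e : R) := forall s, S s ->
  'Np[(fun x : borelType G => psi (s * (x : G))%g - psi x)%R] <= e%:E.

(** For [r > 0] the hypothesis says that [J t] exceeds [r / e], so some [phi] has a quotient of
    norms above [r / e]; [psi] is [|phi|] rescaled to norm [r]. For [r = 0] the zero function
    serves. *)
Lemma near_optimal_function (t r e : R) : (0 <= r)%R -> (0 < e)%R ->
  r%:E / J t < e%:E ->
  exists psi : borelType G -> R, [/\ measurable_fun setT psi,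
    (forall x, 0 <= psi x)%R, 'Np[psi] = r%:E,
    [set x : G | psi x != 0%R] `<=` word_ball S t & slowly_varying psi e].
Proof.
move=> r0 e0; have [-> _|rn0] := eqVneq r 0%R.
  exists (cst 0%R); split => //.
  - by rewrite -[RHS](@Lnorm0 _ _ _ mu p%:E) ?eqe ?gt_eqF.
  - by move=> x; rewrite /= eqxx.
  - move=> s _; rewrite (_ : EFin \o _ = cst 0); last first.
      by apply/funext => x /=; rewrite subrr.
    by rewrite Lnorm0 ?eqe ?gt_eqF// lee_fin ltW.
have {rn0}r0 : (0 < r)%R by rewrite lt_def rn0.
move=> rJ; have : (r / e)%:E < J t.
  have := isoperimetric_profile_ge0 t; move: rJ; case: (J t) => [j| |]// rj.
    rewrite !lee_fin le_eqVlt => /predU1P[j0|j0].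
      by move: rj; rewrite -j0 inve0 gt0_muley ?lte_fin.
    move: rj; rewrite inver gt_eqF// -EFinM !lte_fin ltr_pdivrMr// => rj.
    by rewrite ltr_pdivrMr// mulrC.
  by rewrite ltry.
rewrite lt_max => /orP[|]; first by rewrite lte_fin ltNge divr_ge0 ?ltW.
move=> /ereal_sup_gt[_ [phi [Lphi _ supp] <-]] rq.
have mphi : measurable_fun setT phi by exact: set_mem (sub_Lfun_mfun Lphi).
have Nphi : 'Np[phi] < +oo by exact: set_mem (sub_Lfun_finLfun Lphi).
have D0 : 0 <= 'N[mu]_p%:E[grad S phi] by exact: Lnorm_ge0.
have N0 : 0 <= 'Np[phi] by exact: Lnorm_ge0.
move: rq; set D := 'N[mu]_p%:E[_] in D0 *; set n := 'Np[phi] in Nphi N0 *.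
have nE : n = (fine n)%:E by rewrite fineK// ge0_fin_numE.
rewrite nE => rq.
have n0 : (0 < fine n)%R.
  rewrite lt_def fine_ge0// andbT; apply/eqP => n0; move: rq.
  by rewrite n0 mul0e lte_fin ltNge divr_ge0 ?ltW.
(* A gradient of norm [0] satisfies the bound trivially, and one of infinite norm would make the
   quotient [0]. *)
have De : ((r / fine n)%:E) * D <= e%:E.
  move: rq D0; case: D => [d| |]//.
    rewrite inver; case: (eqVneq d 0%R) => [-> _ _|dn0]; first by rewrite mule0 lee_fin ltW.
    rewrite -!EFinM !lee_fin lte_fin => rq d0.
    have {dn0}d0 : (0 < d)%R by rewrite lt_def dn0.
    move: rq; rewrite ltr_pdivlMr// mulrAC ltr_pdivrMr// => /ltW rq.
    by rewrite mulrAC ler_pdivrMr// [leRHS]mulrC.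
  by rewrite invey mule0 lte_fin => /lt_geF; rewrite divr_ge0// ltW.
have rn0 : (0 <= r / fine n)%R by rewrite divr_ge0 ?ltW.
have mabs : measurable_fun setT (fun x => `|phi x|)%R by exact: measurableT_comp.
exists (fun x => (r / fine n) * `|phi x|)%R; split.
- exact: measurable_funM.
- by move=> x; rewrite mulr_ge0.
- rewrite LnormZ_real// ger0_norm// (_ : EFin \o _ = abse \o (EFin \o phi))//.
  by rewrite Lnorm_abse -/n [X in _ * X]nE -EFinM divfK// gt_eqF.
- by move=> x /=; rewrite mulf_eq0 normr_eq0 negb_or => /andP[_ ?]; exact: supp.
move=> s Ss; apply: le_trans De; rewrite -[(r / _)%R in leRHS]ger0_norm//.
rewrite (_ : EFin \o _ = EFin \o (fun x : borelType G =>
    ((r / fine n) * (`|phi (s * (x : G))%g| - `|phi x|))%R)); last first.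
  by apply/funext => x /=; rewrite mulrBr.
rewrite LnormZ_real//; last exact: (measurable_fun_mulgl_sub s mabs).
apply: lee_wpmul2l => //; apply: le_Lnorm => // x /=.
apply: (@le_trans _ _ (`|phi (s * (x : G))%g - phi x|%:E)%R).
  by rewrite lee_fin ler_dist_dist.
rewrite gee0_abs /grad; last by rewrite le_max lexx.
by rewrite le_max; apply/orP; right; apply: ereal_sup_ubound; exists s.
Qed.

Context (f : R -> R) (f_ge0 : forall t, (0 <= t -> 0 <= f t)%R)
  (f_nd : forall s t, (0 <= s -> s <= t -> f s <= f t)%R).
Context (f_int : \int[lebesgue_measure]_(t in `[1%R, +oo[)
    (((f t)%:E / J t) `^ p * (t^-1)%:E) < +oo).

Lemma near_optimal_sequence :
  exists (psi : nat -> borelType G -> R) (e : nat -> R),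
  [/\ forall k, measurable_fun setT (psi k) /\ (forall x, 0 <= psi k x)%R,
      forall k, 'Np[psi k] = (f (2 ^+ k))%:E,
      forall k, [set x : G | psi k x != 0%R] `<=` nat_ball S (2 ^ k.+1),
      forall k, (0 <= e k)%R /\ slowly_varying (psi k) (e k) &
      \sum_(k <oo) (e k `^ p)%:E < +oo].
Proof.
pose a k := (f (2 ^+ k))%:E / J (2 ^+ k.+1).
have f2 k : (0 <= f (2 ^+ k))%R by rewrite f_ge0// exprn_ge0.
have a0 k : 0 <= a k.
  by apply: mule_ge0; rewrite ?lee_fin// inve_ge0 isoperimetric_profile_ge0.
have sum_a : \sum_(k <oo) (a k `^ p) < +oo.
  by apply: dyadic_sum f_int => //; [exact: isoperimetric_profile_ge0|exact: le_isoperimetric_profile].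
have afin k : a k `^ p \is a fin_num.
  rewrite ge0_fin_numE ?poweR_ge0//; apply: le_lt_trans sum_a.
  apply: le_trans (nneseries_lim_ge k.+1 _); last by move=> *; exact: poweR_ge0.
  by rewrite big_mkord big_ord_recr/= leeDr// sume_ge0// => i _; exact: poweR_ge0.
(* The summable slack [2^-(k+1)] makes [a k < e k] strict and [e k] positive even where [a k]
   vanishes. *)
pose ep k : R := (fine (a k `^ p) + 1 / (2 ^ k.+1)%:R)%R.
have ep0 k : (0 < ep k)%R.
  by rewrite ltr_wpDl ?fine_ge0 ?poweR_ge0// divr_gt0// ltr0n expn_gt0.
pose e k : R := (ep k `^ p^-1)%R.
have e0 k : (0 < e k)%R by exact: powR_gt0.
have ePp k : (e k `^ p)%R = ep k by rewrite -powRrM mulVf ?gt_eqF// powRr1// ltW.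
have ae k : a k < (e k)%:E.
  have lt_p : a k `^ p < (e k)%:E `^ p.
    rewrite poweR_EFin ePp -(fineK (afin k)) lte_fin ltrDl divr_gt0// ltr0n expn_gt0//.
  rewrite ltNge; apply/negP => ea; move: lt_p; apply/negP; rewrite -leNgt.
  by apply: lee_poweR => //; rewrite ?lee_fin ltW.
have ex k := near_optimal_function (f2 k) (e0 k) (ae k).
exists (fun k => sval (cid (ex k))), e; split.
- by move=> k; case: cid => /= psi [].
- by move=> k; case: cid => /= psi [].
- move=> k; case: cid => /= psi [_ _ _ supp _] x /supp.
  by rewrite -natrX => /word_ball_nat.
- by move=> k; case: cid => /= psi [_ _ _ _ sv]; split => //; exact: ltW.
under eq_eseriesr do rewrite ePp EFinD fineK//.
apply: le_lt_trans (epsilon_trick _ _ _) _ => //; first by move=> k; exact: poweR_ge0.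
by rewrite lte_add_pinfty// ltry.
Qed.

End near_optimal.

(** * Sums of distant translates *)

Section separated_translates.
Context (G : groupType) (S : set G) (symS : symmetric_set S).
Context (h : nat -> G).
(* The length of [h k] is exactly [2 ^ (k + 6)]. *)
Hypothesis hball : forall k, nat_ball S (2 ^ (k + 6)) (h k).
Hypothesis hmin : forall k m, nat_ball S m (h k) -> (2 ^ (k + 6) <= m)%N.

(** The ball of radius [2^(k+1)] translated on the right by [h k]: it contains the support of the
    [k]-th function once moved. *)
Definition translated_ball k : set G :=
  [set x | nat_ball S (2 ^ k.+1) (x * (h k)^-1)%g].

Let pow2D k i : (2 ^ (k + i) = 2 ^ k * 2 ^ i)%N. Proof. exact: expnD. Qed.

(** Writing [h k] as [(x h_k^-1)^-1 g^-1 (g x h_j^-1) h_j] gives [2^(k+6) <= 2^(k+1) + 2^(k+3) +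
    2^(j+1) + 2^(j+6)]. Since [2^(j+1) <= 2^k], the right side is at most [43 * 2^k], less than
    [64 * 2^k]. *)
Lemma translated_ball_lt j k g x : (j < k)%N -> nat_ball S (2 ^ (k + 3)) g ->
  translated_ball k x -> translated_ball j (g * x)%g -> False.
Proof.
move=> jk Sg Dx Dgx.
have := nat_ballM (nat_ballM (nat_ballV symS Dx) (nat_ballV symS Sg))
                  (nat_ballM Dgx (hball j)).
rewrite mulgVK invgM invgK -!mulgA mulKg mulVg mulg1 => /hmin.
have : (2 ^ j * 2 <= 2 ^ k)%N by rewrite -expnSr leq_exp2l.
have : (0 < 2 ^ k)%N by rewrite expn_gt0.
by rewrite !pow2D !expnS !expn0; move: (2 ^ j)%N (2 ^ k)%N => a b; lia.
Qed.

Lemma translated_ball_inj m j k g x : nat_ball S m g ->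
  (m <= 2 ^ (maxn j k + 3))%N ->
  translated_ball k x -> translated_ball j (g * x)%g -> j = k.
Proof.
move=> gm mjk Dk Dj; have [jk|kj|//] := ltngtP j k.
  exfalso; apply: (translated_ball_lt jk _ Dk Dj).
  by apply: nat_ball_le gm; move: mjk; rewrite (maxn_idPr (ltnW jk)).
exfalso; apply: (translated_ball_lt kj (g := g^-1%g) _ Dj); last by rewrite mulKg.
apply: (nat_ballV symS); apply: nat_ball_le gm.
by move: mjk; rewrite (maxn_idPl (ltnW kj)).
Qed.

(** [g] is [(g x h_k^-1) (x h_k^-1)^-1], a product of two elements of length at most [2^(k+1)].
    Hence an element of length above [2^(k+2)] moves the translated ball off itself. *)
Lemma translated_ball_diag k g x : translated_ball k x ->
  translated_ball k (g * x)%g -> nat_ball S (2 ^ (k + 2)) g.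
Proof.
move=> Dx Dgx; have := nat_ballM Dgx (nat_ballV symS Dx).
rewrite invgM invgK -!mulgA mulKg mulgV mulg1.
by apply: nat_ball_le; rewrite !pow2D !expnS !expn0; move: (2 ^ k)%N => a; lia.
Qed.

End separated_translates.

(** * Effect of translations on [L^p] norms *)

Section translates.
Context (R : realType) (G : topologicalGroupType) (hG : hausdorff_space G).
Context (mu : {measure set (borelType G) -> \bar R}) (hmu : left_haar mu).
Context (S : set G) (p : R) (p1 : 1 < p).
Local Open Scope ereal_scope.
Local Notation "'Np[ f ]" := ('N[mu]_p%:E[EFin \o f]) (format "''Np[' f ]").

Let p0 : (0 < p)%R. Proof. exact: lt_trans p1. Qed.

(** The constant [d] is [c^(-1/p)], with [c] the modular factor of [g]; it compensates for the right
    translation. *)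
Lemma Lnorm_mulgr (g : G) : exists2 d : R, (0 < d)%R &
  forall F : borelType G -> R, measurable_fun setT F ->
    'Np[(fun x : borelType G => d * F ((x : G) * g)%g)%R] = 'Np[F].
Proof.
have [c c0 cE] := haar_modular hG hmu g.
exists (c^-1 `^ p^-1)%R; first by rewrite powR_gt0 ?invr_gt0.
move=> F mF; rewrite unlock /Lnorm; congr (_ `^ _).
have mFp := measurable_fun_normrpowR p mF.
transitivity (\int[mu]_x ((c^-1)%:E * (`|F ((x : G) * g)%g| `^ p)%:E)).
  apply: eq_integral => x _ /=.
  rewrite normrM powRM// ger0_norm ?powR_ge0// -powRrM mulVf ?gt_eqF//.
  by rewrite powRr1 ?invr_ge0 ?ltW.
rewrite ge0_integralZl//; last 2 first.
- by apply: (@measurable_fun_normrpowR _ _ _ p (fun x : borelType G => F ((x : G) * g)%g));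
    apply: (measurableT_comp mF); exact: measurable_mulgr.
- by rewrite lee_fin invr_ge0 ltW.
rewrite (cE (fun x => (`|F x| `^ p)%:E))//.
by rewrite muleA -EFinM mulVf ?gt_eqF// mul1e.
Qed.

(** Telescoping along a word for [g]: each letter contributes one increment, moved by a left
    translation, which preserves the norm. *)
Lemma slowly_varying_nat_ball (F : borelType G -> R) (e : R) n g :
  measurable_fun setT F -> (0 <= e)%R -> slowly_varying mu S p F e -> nat_ball S n g ->
  'Np[(fun x : borelType G => F (g * (x : G))%g - F x)%R] <= (n%:R * e)%:E.
Proof.
move=> mF e0 Fe [m mn Sg].
apply: (@le_trans _ _ (m%:R * e)%:E); last by rewrite lee_fin ler_wpM2r ?ler_nat.
elim: m g Sg {mn} => [_ /= ->|m IH _ [s Ss [g Sg <-]]].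
  rewrite (_ : EFin \o _ = cst 0).
    by rewrite Lnorm0 ?mul0r// eqe gt_eqF.
  by apply/funext => x /=; rewrite mul1g subrr.
have mFs := measurable_fun_mulgl_sub s mF.
have mFg := measurable_fun_mulgl_sub g mF.
rewrite -natr1 mulrDl mul1r addrC EFinD.
apply: le_trans (leeD (Fe _ Ss) (IH _ Sg)).
rewrite -(Lnorm_mulgl hmu p g mFs).
apply: le_trans (minkowski_EFin _ _ _ (ltW p1)); rewrite ?le_eqVlt.
- apply/orP; left; apply/eqP; congr Lnorm; apply/funext => x /=.
  by rewrite mulgA; congr EFin; lra.
- exact: (measurable_fun_mulgl g mFs).
- exact: mFg.
Qed.

End translates.

(** * Sums of functions with disjoint supports *)

Section disjoint_sum.
Context (R : realType) (G : topologicalGroupType).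
Context (mu : {measure set (borelType G) -> \bar R}).
Context (S : set G) (p : R) (p1 : 1 < p).
Local Open Scope ereal_scope.
Local Notation "'Np[ f ]" := ('N[mu]_p%:E[EFin \o f]) (format "''Np[' f ]").

Let p0 : (0 < p)%R. Proof. exact: lt_trans p1. Qed.

Variable u : nat -> borelType G -> R.
Hypothesis u0 : forall k x, (0 <= u k x)%R.
Hypothesis mu_ : forall k, measurable_fun setT (u k).

(** The series is taken in the extended reals, where nonnegative terms always sum; for disjoint
    supports at most one term is nonzero, so [fine] loses nothing. *)
Definition disjoint_sum (x : borelType G) : R := fine (\sum_(k <oo) (u k x)%:E).

Lemma measurable_disjoint_sum : measurable_fun setT disjoint_sum.
Proof.
apply: (measurableT_comp (f := fine)) => //.
apply: ge0_emeasurable_sum => // k; first by move=> x _ _; rewrite lee_fin.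
by move=> _; apply/measurable_EFinP.
Qed.

Hypothesis u_disj : forall x j k, (u j x != 0 -> u k x != 0 -> j = k)%R.

Lemma disjoint_sumE k x : (u k x != 0)%R -> disjoint_sum x = u k x.
Proof.
move=> uk; rewrite /disjoint_sum (_ : \sum_(i <oo) _ = (u k x)%:E)//.
apply/eqP; rewrite eq_le; apply/andP; split.
  apply: nneseries_le_disjoint => [i|i|i j].
  - by rewrite lee_fin.
  - have [->|ui] := eqVneq (u i x) 0%R; first by rewrite lee_fin.
    by rewrite (u_disj ui uk).
  - by rewrite !eqe; exact: u_disj.
apply: le_trans (nneseries_lim_ge k.+1 _); last by move=> *; rewrite lee_fin.
by rewrite big_mkord big_ord_recr/= leeDr// sume_ge0// => i _; rewrite lee_fin.
Qed.

Lemma disjoint_sum0 x : (forall k, u k x = 0)%R -> disjoint_sum x = 0%R.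
Proof. by move=> ux; rewrite /disjoint_sum eseries0// => k _ _; rewrite ux. Qed.

Hypothesis u_sep : forall s x j k, S s ->
  (u j x != 0 -> u k (s * (x : G))%g != 0 -> j = k)%R.

(** For fixed [s] and [x], separation leaves at most one [k] for which [u k x] or [u k (s x)] is
    nonzero, so the increment of the sum is that of a single [u k]. Its [p]-th power is bounded by
    the series of all such powers, which is integrated term by term. *)
Lemma disjoint_sum_slowly_varying (e : nat -> R) (c : R) :
  (forall k, 0 <= e k)%R -> (forall k, slowly_varying mu S p (u k) (e k)) ->
  (0 <= c)%R -> \sum_(k <oo) (e k `^ p)%:E <= (c `^ p)%:E ->
  slowly_varying mu S p disjoint_sum c.
Proof.
move=> e0 ue c0 sum_e s Ss; apply: Lnorm_lefin => //; apply: le_trans sum_e.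
have mt k := measurable_fun_normrpowR p (measurable_fun_mulgl_sub s (@mu_ k)).
apply: (@le_trans _ _ (\sum_(k <oo) \int[mu]_x (`|u k (s * (x : G))%g - u k x| `^ p)%:E)).
  rewrite -integral_nneseries//.
  apply: ge0_integral_le => x; first by rewrite lee_fin powR_ge0.
  have term k : (`|u k (s * (x : G))%g - u k x| `^ p)%:E <=
      \sum_(i <oo) (`|u i (s * (x : G))%g - u i x| `^ p)%:E.
    apply: le_trans (nneseries_lim_ge k.+1 _); last by move=> *; rewrite lee_fin powR_ge0.
    rewrite big_mkord big_ord_recr/= leeDr//.
    by apply: sume_ge0 => i _; rewrite lee_fin powR_ge0.
  have [[k /orP uk]|/forallNP unull] := pselect (exists k,
      (u k x != 0%R) || (u k (s * (x : G))%g != 0%R)); last first.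
    have un k : (u k x = 0 /\ u k (s * (x : G))%g = 0)%R.
      by move/negP : (unull k); rewrite negb_or !negbK => /andP[/eqP ? /eqP].
    rewrite !disjoint_sum0 ?subrr ?normr0 ?powR0 ?gt_eqF//; last 2 first.
      by move=> k; case: (un k).
      by move=> k; case: (un k).
    by apply: nneseries_ge0 => *; rewrite lee_fin powR_ge0.
  have gx : disjoint_sum x = u k x.
    have [ukx|ukx] := eqVneq (u k x) 0%R; last exact: disjoint_sumE.
    rewrite ukx; apply: disjoint_sum0 => j; apply/eqP/negPn/negP => uj.
    have uks : (u k (s * (x : G))%g != 0)%R by case: uk; rewrite ?ukx ?eqxx.
    by move: (uj); rewrite (u_sep Ss uj uks) ukx eqxx.
  have gsx : disjoint_sum (s * (x : G))%g = u k (s * (x : G))%g.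
    have [uks|uks] := eqVneq (u k (s * (x : G))%g) 0%R; last exact: disjoint_sumE.
    rewrite uks; apply: disjoint_sum0 => j; apply/eqP/negPn/negP => uj.
    have ukx : (u k x != 0)%R by case: uk; rewrite ?uks ?eqxx.
    by move: (uj); rewrite -(u_sep Ss ukx uj) uks eqxx.
  by rewrite gx gsx; exact: term.
apply: lee_nneseries => [k _ _|k _].
  by apply: integral_ge0 => x _; rewrite lee_fin powR_ge0.
rewrite -Lnorm_powE// -poweR_EFin; apply: lee_poweR; [exact: ltW|exact: Lnorm_ge0|exact: ue].
Qed.

End disjoint_sum.

(** * Cocycles with values in L^p *)

Section Lspace_of_fun.
Context d (T : measurableType d) (R : realType).
Variable mu : {measure set T -> \bar R}.
Local Open Scope ereal_scope.

Lemma ae_eq_Lnorm (p : R) (f g : T -> R) : measurable_fun setT f -> measurable_fun setT g ->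
  f = g %[ae mu] -> 'N[mu]_p%:E[EFin \o f] = 'N[mu]_p%:E[EFin \o g].
Proof.
move=> mf mg fg; rewrite unlock /Lnorm; congr (_ `^ _).
apply: ae_eq_integral => //.
- exact: (measurable_fun_normrpowR p mf).
- exact: (measurable_fun_normrpowR p mg).
by apply: filterS fg => x /(_ I) fgx _ /=; rewrite fgx.
Qed.

Lemma measurable_Lspace (p : \bar R) (p1 : 1 <= p) (b : LspaceType mu p1) :
  measurable_fun setT (b : T -> R).
Proof. exact: (measurable_funPT (repr (b : {mfun_ mu, T >-> measurableTypeR R})%qT)). Qed.

Lemma Lspace_of_fun (p : R) (p1 : 1 <= p%:E) (f : T -> R) :
  measurable_fun setT f -> 'N[mu]_p%:E[EFin \o f] < +oo ->
  exists b : LspaceType mu p1, (b : T -> R) = f %[ae mu].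
Proof.
move=> mf Nf.
pose mff := isMeasurableFun.Build _ _ T (measurableTypeR R) f mf.
pose F : {mfun T >-> measurableTypeR R} := HB.pack f mff.
pose q : {mfun_ mu, T >-> measurableTypeR R} := (\pi_({mfun_ mu, T >-> measurableTypeR R}) F)%qT.
have qf : (q : T -> R) = f %[ae mu].
  have /eqmodP := reprK q. by move/asboolP.
have Nq : finite_norm mu p%:E q.
  rewrite /finite_norm (@ae_eq_Lnorm p _ f) //.
  exact: (measurable_funPT (repr q)).
pose LB := isFinLebesgue.Build _ T R mu p%:E p1 q Nq.
pose b : LspaceType mu p1 := HB.pack q LB.
by exists b.
Qed.

End Lspace_of_fun.

Section cocycle.
Context (R : realType) (G : topologicalGroupType).
Context (mu : {measure set (borelType G) -> \bar R}) (hmu : left_haar mu).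
Local Open Scope ereal_scope.

Lemma ae_eq_left_regular (g : G) (f1 f2 : borelType G -> R) :
  f1 = f2 %[ae mu] -> left_regular g f1 = left_regular g f2 %[ae mu].
Proof.
move=> [A [mA A0 fA]]; exists [set x : G | A (g^-1 * x)%g]; split.
- exact: measurable_set_mulgl.
- by rewrite haar_mulgl.
by move=> x /= nx; apply: fA => /= H; apply: nx => _; exact: H.
Qed.

(** The cocycle identity for [F - lambda(g) F] is formal, so [F] itself may have infinite norm. Left
    invariance turns the norm of [b h - b g] into that of the increment of [F] under [h^-1 g], which
    tends to [1] as [h] tends to [g]; continuity thus reduces to the identity. *)
Lemma left_regular_cocycle_coboundary (p : R) (p1 : 1 <= p%:E)
    (F : borelType G -> R) (b : G -> LspaceType mu p1) :
  measurable_fun setT F ->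
  (forall g, (b g : borelType G -> R) =
    (fun x : borelType G => F x - F (g^-1 * (x : G))%g)%R %[ae mu]) ->
  (forall e : R, (0 < e)%R -> \forall u \near (1%g : G),
    'N[mu]_p%:E[EFin \o (fun x : borelType G => F (u * (x : G))%g - F x)%R] <= e%:E) ->
  left_regular_cocycle b.
Proof.
move=> mF bE Fcont; split; last first.
  move=> g h; apply: ae_eq_trans (bE (g * h)%g) _.
  have := ae_eq_left_regular g (bE h).
  apply: filterS2 (bE g) => x /(_ I) bg /(_ I) lh _.
  rewrite /= bg lh /left_regular /= invgM mulgA; lra.
move=> g.
have NE h : 'N[mu]_p%:E[EFin \o (b h \- b g)%R] =
    'N[mu]_p%:E[EFin \o (fun x : borelType G => F (h^-1 * g * (x : G))%g - F x)%R].
  rewrite (@ae_eq_Lnorm _ _ _ _ p _ (fun x : borelType G => F (g^-1 * (x : G))%g - F (h^-1 * (x : G))%g)%R); last 3 first.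
  - by apply: measurable_funB; exact: measurable_Lspace.
  - by apply: measurable_funB; exact: measurable_fun_mulgl.
  - by apply: filterS2 (bE g) (bE h) => x /(_ I) bg /(_ I) bh _; rewrite /= bg bh; lra.
  rewrite -(Lnorm_mulgl hmu p g); last by apply: measurable_funB; exact: measurable_fun_mulgl.
  rewrite -oppe_Lnorm; congr Lnorm; apply/funext => x /=.
  by rewrite mulKg mulgA opprB.
have cg : (fun h : G => (h^-1 * g)%g) @ g --> (1%g : G).
  rewrite -(mulVg g).
  apply: (@continuous_comp _ _ _ (fun z : G => z^-1%g) (fun z : G => (z * g)%g)).
    exact: invg_continuous.
  exact: mulgr_continuous.
have small (e : R) : (0 < e)%R -> \forall h \near g, 'N[mu]_p%:E[EFin \o (b h \- b g)%R] <= e%:E.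
  move=> e0; have cgF : \forall h \near g,
      'N[mu]_p%:E[EFin \o (fun x : borelType G => F (h^-1 * g * (x : G))%g - F x)%R] <= e%:E.
    exact: cg _ (Fcont _ e0).
  by apply: filterS cgF => h; rewrite NE.
apply/fine_cvgP; split.
  apply: filterS (small _ ltr01) => h hN.
  by rewrite ge0_fin_numE ?Lnorm_ge0// (le_lt_trans hN)// ltry.
apply/cvgrPdist_le => e e0; apply: filterS (small _ e0) => h hN.
rewrite sub0r normrN ger0_norm ?fine_ge0 ?Lnorm_ge0//= -lee_fin fineK//.
by rewrite ge0_fin_numE ?Lnorm_ge0// (le_lt_trans hN)// ltry.
Qed.

End cocycle.

(** * Continuity of the formal coboundary at the identity *)

Section disjoint_sum_continuous.
Context (R : realType) (G : topologicalGroupType) (hG : hausdorff_space G).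
Context (mu : {measure set (borelType G) -> \bar R}) (hmu : left_haar mu).
Context (S : set G) (cS : compact S) (sS : symmetric_set S) (genS : generating_set S).
Context (p : R) (p1 : 1 < p).
Local Open Scope ereal_scope.
Local Notation "'Np[ f ]" := ('N[mu]_p%:E[EFin \o f]) (format "''Np[' f ]").

Let p0 : (0 < p)%R. Proof. exact: lt_trans p1. Qed.

Variables (u : nat -> borelType G -> R) (e : nat -> R).
Hypothesis u0 : forall k x, (0 <= u k x)%R.
Hypothesis mu_ : forall k, measurable_fun setT (u k).
Hypothesis Nu : forall k, 'Np[u k] < +oo.
Hypothesis u_disj : forall x j k, (u j x != 0 -> u k x != 0 -> j = k)%R.
Hypothesis u_sep : forall s x j k, S s ->
  (u j x != 0 -> u k (s * (x : G))%g != 0 -> j = k)%R.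
Hypothesis e0 : forall k, (0 <= e k)%R.
Hypothesis ue : forall k, slowly_varying mu S p (u k) (e k).
Hypothesis sum_e : \sum_(k <oo) (e k `^ p)%:E < +oo.

(** Zeroing the first [N] terms, instead of reindexing, lets [tail] inherit disjointness and
    separation from [u] with the same indices. *)
Let tail N k (x : borelType G) : R := if (N <= k)%N then u k x else 0%R.

Let head N (x : borelType G) : R := (\sum_(k < N) u k x)%R.

Let tail_neq0 N k x : (tail N k x != 0)%R -> (u k x != 0)%R.
Proof. by rewrite /tail; case: ifP => // _; rewrite eqxx. Qed.

Let disjoint_sum_head_tail N x : disjoint_sum u x = (head N x + disjoint_sum (tail N) x)%R.
Proof.
have t0 k y : (0 <= tail N k y)%R by rewrite /tail; case: ifP.
have t_disj y j k : (tail N j y != 0 -> tail N k y != 0 -> j = k)%R.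
  by move=> /tail_neq0 + /tail_neq0; exact: u_disj.
have [[k uk]|/forallNP unull] := pselect (exists k, (u k x != 0)%R); last first.
  have un k : u k x = 0%R by apply/eqP/negPn/negP/unull.
  rewrite !disjoint_sum0 ?addr0 /head; [by rewrite big1|by move=> k; rewrite /tail un if_same|by []].
have un j : j != k -> u j x = 0%R.
  by apply: contra_neqP => /eqP uj; exact: u_disj uj uk.
rewrite (disjoint_sumE u0 u_disj uk); have [Nk|kN] := leqP N k.
  have tk : (tail N k x != 0)%R by rewrite /tail Nk.
  rewrite (disjoint_sumE t0 t_disj tk) /tail Nk /head big1 ?add0r// => i _.
  by apply: un; have := ltn_ord i; lia.
rewrite disjoint_sum0 ?addr0.
  by rewrite /head (bigD1 (Ordinal kN))//= big1 ?addr0// => i ik; exact: un.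
move=> j; rewrite /tail; case: ifP => // Nj; apply: un; lia.
Qed.

Let sum_tail N : \sum_(k <oo) ((if (N <= k)%N then e k else 0%R) `^ p)%:E =
  \sum_(N <= k <oo) (e k `^ p)%:E.
Proof.
rewrite [RHS]ereal_series_cond [RHS]eseries_mkcond.
apply: eq_eseriesr => k _; rewrite andbT.
by case: ifP => //; rewrite powR0// gt_eqF.
Qed.

(** The finite sum [head] lies in [L^p], where translations are continuous. The sum of the [tail]
    has increments at most [d] along [S], and some ball of radius [n] is a neighbourhood of [1], so
    nearby translations change it by at most [n * d <= c / 2]. *)
Lemma disjoint_sum_shift_small (c : R) : (0 < c)%R -> \forall g \near (1%g : G),
  'Np[(fun x : borelType G => disjoint_sum u (g * (x : G))%g - disjoint_sum u x)%R] <= c%:E.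
Proof.
move=> c0.
have [n nbhs_n] := nat_ball_nbhs1 cS hG sS genS hmu.
pose d := (c / 2 / n.+1%:R)%R.
have d0 : (0 < d)%R by rewrite !divr_gt0.
have [N tailN] : exists N, \sum_(N <= k <oo) (e k `^ p)%:E <= (d `^ p)%:E.
  have /fine_cvgP[finN /cvgrPdist_le cvgN] := nneseries_tail_cvg sum_e (fun k _ => powR_ge0 _ _).
  have dp0 : (0 < d `^ p)%R by exact: powR_gt0.
  near \oo => N; exists N.
  have fN : \sum_(N <= k <oo) (e k `^ p)%:E \is a fin_num by near: N.
  rewrite -(fineK fN) lee_fin; apply: le_trans (ler_norm _) _.
  by rewrite -normrN -sub0r; near: N; exact: cvgN.
have m_head : measurable_fun setT (head N) by exact: measurable_sum.
have head0 x : (0 <= head N x)%R by exact: sumr_ge0.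
have Nhead : 'Np[head N] < +oo.
  rewrite /head; elim: N {tailN m_head head0} => [|N IH].
    rewrite (_ : EFin \o _ = cst 0) ?Lnorm0 ?eqe ?gt_eqF//.
    by apply/funext => x /=; rewrite big_ord0.
  rewrite (_ : EFin \o _ = EFin \o ((fun x => \sum_(k < N) u k x) \+ u N)%R); last first.
    by apply/funext => x /=; rewrite big_ord_recr.
  apply: le_lt_trans (minkowski_EFin _ _ _ (ltW p1)) _ => //.
    exact: measurable_sum.
  by rewrite lte_add_pinfty.
have m_tail k : measurable_fun setT (tail N k).
  by rewrite /tail; case: (N <= k)%N.
have t0 k y : (0 <= tail N k y)%R by rewrite /tail; case: ifP.
have mgt : measurable_fun setT (disjoint_sum (tail N)) by exact: measurable_disjoint_sum.
have tail_slow : slowly_varying mu S p (disjoint_sum (tail N)) d.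
  apply: (@disjoint_sum_slowly_varying _ _ mu S p p1 (tail N) t0 m_tail _ _
    (fun k => if (N <= k)%N then e k else 0%R)).
  - by move=> y j k /tail_neq0 + /tail_neq0; exact: u_disj.
  - by move=> s y j k Ss /tail_neq0 + /tail_neq0; exact: u_sep.
  - by move=> k; case: ifP.
  - move=> k s Ss; rewrite /tail; case: ifP => Nk; first exact: ue.
    rewrite (_ : EFin \o _ = cst 0) ?Lnorm0 ?eqe ?gt_eqF//.
    by apply/funext => x /=; rewrite subrr.
  - exact: ltW.
  - by rewrite sum_tail.
have c20 : (0 < c / 2)%R by exact: divr_gt0.
apply: filterS2 nbhs_n (shift_continuous_Lp hG hmu (ltW p1) m_head head0 Nhead c20) => g gn gh.
have gt := slowly_varying_nat_ball hmu p1 mgt (ltW d0) tail_slow gn.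
rewrite (splitr c) EFinD.
apply: (@le_trans _ _ ('Np[(fun x : borelType G => head N (g * (x : G))%g - head N x)%R] +
  'Np[(fun x : borelType G => disjoint_sum (tail N) (g * (x : G))%g - disjoint_sum (tail N) x)%R])).
  apply: le_trans (minkowski_EFin _ _ _ (ltW p1)); rewrite ?le_eqVlt.
  - apply/orP; left; apply/eqP; congr Lnorm; apply/funext => x /=.
    by rewrite !(disjoint_sum_head_tail N); congr EFin; lra.
  - exact: measurable_fun_mulgl_sub.
  - exact: measurable_fun_mulgl_sub.
rewrite leeD//; apply: le_trans gt _; rewrite lee_fin /d mulrCA ler_piMr ?(ltW c20)//.
by rewrite ler_pdivrMr// mul1r ler_nat.
Unshelve. all: by end_near. Qed.

End disjoint_sum_continuous.

(** [k] is the largest integer with [2^(k+2) < m]; the bound [8 <= m] ensures that [k = 0]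
    qualifies. *)
Lemma dyadic_scale (m : nat) : (8 <= m)%N ->
  exists2 k, (2 ^ (k + 2) < m)%N & (m <= 2 ^ (k + 3))%N.
Proof.
move=> m8.
have bnd k : (2 ^ (k + 2) < m)%N -> (k <= m)%N.
  by have := ltn_expl (k + 2) (isT : 1 < 2)%N; lia.
have ex0 : exists k, (2 ^ (k + 2) < m)%N by exists 0%N; apply: leq_trans m8.
case: (ex_maxnP ex0 bnd) => k km kmax; exists k => //.
rewrite leqNgt; apply/negP => mk.
have := kmax k.+1; rewrite addSn -addnS => /(_ mk); lia.
Qed.

(** * Construction of the cocycle *)

Section cocycle_construction.
Context (R : realType) (G : topologicalGroupType) (hG : hausdorff_space G).
Context (S : set G) (cS : compact S) (sS : symmetric_set S) (genS : generating_set S).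
Context (mu : {measure set (borelType G) -> \bar R}) (hmu : left_haar mu).
Context (p : R) (p1 : 1 < p).
Context (f : R -> R) (f_ge0 : forall t, 0 <= t -> 0 <= f t)
  (f_nd : forall s t, 0 <= s -> s <= t -> f s <= f t).
Local Open Scope ereal_scope.
Context (f_int : \int[lebesgue_measure]_(t in `[1%R, +oo[)
    (((f t)%:E / isoperimetric_profile mu S p t) `^ p * (t^-1)%:E) < +oo).
Local Notation "'Np[ g ]" := ('N[mu]_p%:E[EFin \o g]) (format "''Np[' g ]").

Let p0 : (0 < p)%R. Proof. exact: lt_trans p1. Qed.

Lemma cocycle_bounded n : (forall g, nat_ball S n g) ->
  exists b : G -> LspaceType mu (exponent_ge1 p1),
    left_regular_cocycle b /\ asymp_le (EFin \o f) (compression S b).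
Proof.
move=> bnd.
have N0 : 'Np[cst 0%R] < +oo.
  by rewrite (_ : EFin \o _ = cst 0)// Lnorm0// eqe gt_eqF.
have m0 : measurable_fun setT (cst 0%R : borelType G -> R) by [].
have [b bE] := Lspace_of_fun (exponent_ge1 p1) m0 N0.
exists (fun=> b); split.
  apply: (@left_regular_cocycle_coboundary _ _ _ hmu p _ (cst 0%R)) => //.
    by move=> g; apply: filterS bE => x /[apply] ->; rewrite /= subrr.
  move=> e e0; apply: nearW => u.
  rewrite (_ : EFin \o _ = cst 0) ?Lnorm0 ?eqe ?gt_eqF// ?lee_fin ?ltW//.
  by apply/funext => x /=; rewrite subrr.
exists 1%R => //; exists 1%R => //; near=> t.
(* For [t > n] no element is admissible and the infimum is [+oo], whatever [f t] is. *)
rewrite mul1r /compression [X in _ @` X](_ : _ = set0).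
  by rewrite image_set0 ereal_inf0 mul1e leey.
rewrite -subset0 => g /= tg; have /(word_ball_nat S R) := bnd g.
rewrite /word_ball /= => gn; have := le_trans tg gn.
by rewrite lee_fin leNgt; apply/negP/negPn; near: t; exact: nbhs_pinfty_gt.
Unshelve. all: by end_near. Qed.

Lemma cocycle_unbounded : (forall n, exists g, ~ nat_ball S n g) ->
  exists b : G -> LspaceType mu (exponent_ge1 p1),
    left_regular_cocycle b /\ asymp_le (EFin \o f) (compression S b).
Proof.
move=> unbnd.
have [psi [e [psiP Npsi psi_supp e_sv sum_e]]] := near_optimal_sequence p1 f_ge0 f_nd f_int.
have /choice[h hP] : forall k, exists g, nat_ball S (2 ^ (k + 6)) g /\
    forall m, nat_ball S m g -> (2 ^ (k + 6) <= m)%N.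
  move=> k; have [g gk gm] := nat_ball_exact genS (unbnd (2 ^ (k + 6))%N).
  by exists g.
have hball k := (hP k).1; have hmin k := (hP k).2.
have /choice[d dP] : forall k, exists d : R, (0 < d)%R /\
    forall F : borelType G -> R, measurable_fun setT F ->
    'Np[(fun x : borelType G => d * F ((x : G) * (h k)^-1)%g)%R] = 'Np[F].
  by move=> k; have [d d0 dN] := Lnorm_mulgr hG hmu p1 (h k)^-1%g; exists d.
have mpsi k := (psiP k).1; have psi0 k := (psiP k).2.
(* [d k] corrects the modular factor, so [u k] keeps the norm [f (2^k)]; left increments commute
   with the right translation. *)
pose u k (x : borelType G) : R := (d k * psi k ((x : G) * (h k)^-1)%g)%R.
have u0 k x : (0 <= u k x)%R by apply: mulr_ge0 => //; apply: ltW; case: (dP k).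
have m_u k : measurable_fun setT (u k).
  by apply: measurable_funM => //; apply: (measurableT_comp (mpsi k)); exact: measurable_mulgr.
have Nu k : 'Np[u k] = (f (2 ^+ k))%:E by rewrite (dP k).2// Npsi.
have u_supp k (x : G) : (u k x != 0)%R -> translated_ball S h k x.
  by rewrite mulf_eq0 negb_or => /andP[_]; exact: psi_supp.
have u_sv k : slowly_varying mu S p (u k) (e k).
  move=> s Ss; have := (e_sv k).2 s Ss.
  rewrite -(dP k).2; last exact: measurable_fun_mulgl_sub.
  apply: le_trans; rewrite le_eqVlt; apply/orP; left; apply/eqP; congr Lnorm.
  by apply/funext => x /=; rewrite /u mulrBr mulgA.
(* Radius [8 = 2^3] is within the separation bound at every scale; it covers both [g] in [S] and
   [g = 1], the latter giving disjoint supports. *)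
have u_sep g x j k : nat_ball S 8 g -> (u j x != 0 -> u k (g * (x : G))%g != 0 -> j = k)%R.
  move=> g8 /u_supp Dx /u_supp Dgx; apply/esym.
  apply: (translated_ball_inj sS hball hmin g8 _ Dx Dgx).
  by rewrite (@leq_exp2l 2 3)// leq_addl.
have u_sepS s x j k : S s -> (u j x != 0 -> u k (s * (x : G))%g != 0 -> j = k)%R.
  by move=> Ss; apply: u_sep; apply: nat_ball_le (nat_ball_sub Ss).
have u_disj x j k : (u j x != 0 -> u k x != 0 -> j = k)%R.
  by move=> uj uk; apply: (@u_sep 1%g x) => //; [exact: nat_ball1|rewrite mul1g].
have e0 k := (e_sv k).1.
pose F := disjoint_sum u.
have mF : measurable_fun setT F by exact: measurable_disjoint_sum.
pose c := (fine (\sum_(k <oo) (e k `^ p)%:E) `^ p^-1)%R.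
have F_sv : slowly_varying mu S p F c.
  apply: (@disjoint_sum_slowly_varying _ _ mu S p p1 u u0 m_u u_disj u_sepS e) => //.
    exact: powR_ge0.
  have sum0 : 0 <= \sum_(k <oo) (e k `^ p)%:E.
    by apply: nneseries_ge0 => *; rewrite lee_fin powR_ge0.
  rewrite /c -powRrM mulVf ?gt_eqF// powRr1 ?fine_ge0// fineK//.
  by rewrite ge0_fin_numE.
pose Fg (g : G) (x : borelType G) : R := (F x - F (g^-1 * (x : G))%g)%R.
have mFg g : measurable_fun setT (Fg g).
  by apply: measurable_funB => //; exact: measurable_fun_mulgl.
(* [F] may have infinite norm, but a word of length at most [n] for [g^-1] bounds the increment by
   [n * c]. *)
have NFg g : 'Np[Fg g] < +oo.
  have [n /(nat_ballV sS) gn] := generating_nat_ball genS g.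
  have := slowly_varying_nat_ball hmu p1 mF (powR_ge0 _ _) F_sv gn.
  rewrite -oppe_Lnorm (_ : \- _ = EFin \o Fg g); last first.
    by apply/funext => x /=; rewrite /Fg opprB.
  by move=> /le_lt_trans; apply; exact: ltry.
have /choice[b bE] : forall g, exists b : LspaceType mu (exponent_ge1 p1),
    (b : borelType G -> R) = Fg g %[ae mu].
  by move=> g; exact: Lspace_of_fun.
exists b; split.
  apply: (@left_regular_cocycle_coboundary _ _ _ hmu p _ F) => //.
  move=> c' c'0; apply: (@disjoint_sum_shift_small _ _ hG mu hmu S cS sS genS p p1 u e) => //.
  by move=> k; rewrite Nu ltry.
(* The factor [8] absorbs the loss in [m <= 2^(k+3)]: from [8 t <= m] follows [t <= 2^k]. *)
exists 8%R => //; exists 1%R => //; near=> t.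
rewrite mul1e; apply: le_ereal_inf_tmp => _ [g /= tg <-].
have t1 : (1 <= t)%R by near: t; exact: nbhs_pinfty_ge.
have [m [gm gball gmin]] := word_lengthP R genS g.
move: tg; rewrite gm lee_fin => tm.
have m8 : (8 <= m)%N.
  by rewrite -(ler_nat R); apply: le_trans tm; rewrite ler_peMr.
have [k km mk] := dyadic_scale m8.
have ft : (f t <= f (2 ^+ k))%R.
  apply: f_nd; first by rewrite (le_trans ler01).
  rewrite -(ler_pM2l (_ : 0 < 8)%R)//; apply: (le_trans tm).
  have -> : (8 = 2 ^+ 3 :> R)%R by rewrite -natrX.
  by rewrite -exprD -natrX ler_nat addnC.
apply: (@le_trans _ _ (f (2 ^+ k))%:E); first by rewrite lee_fin.
rewrite (ae_eq_Lnorm p (measurable_Lspace (b g)) (mFg g) (bE g)) -Nu.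
(* It suffices that the coboundary [Fg g] agrees with [u k] where [u k] is nonzero. *)
apply: le_Lnorm => // x /=; rewrite lee_fin.
have [->|ukx] := eqVneq (u k x) 0%R; first by rewrite normr0.
rewrite /Fg /F (disjoint_sumE u0 u_disj ukx) disjoint_sum0 ?subr0//.
(* Suppose [u j] is nonzero at [g^-1 x]. Separation applies because [m <= 2^(k+3)], and forces
   [j = k]; then [g] would have length at most [2^(k+2)], contrary to the choice of [k]. *)
move=> j; apply/eqP/negPn/negP => uj.
have Dk := u_supp _ _ ukx; have Dj := u_supp _ _ uj.
have gV : nat_ball S m g^-1%g by exact: nat_ballV.
have jk : j = k.
  apply: (translated_ball_inj sS hball hmin gV _ Dk Dj).
  by apply: leq_trans mk _; rewrite leq_exp2l// leq_add2r leq_maxr.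
move: Dj; rewrite jk => /(translated_ball_diag sS Dk)/(nat_ballV sS).
by rewrite invgK => /gmin; rewrite leqNgt km.
Unshelve. all: by end_near. Qed.

End cocycle_construction.

Unset Implicit Arguments.

Theorem theorem10 (R : realType) (G : topologicalGroupType)
  (hausG : hausdorff_space G) (lcG : locally_compact [set: G])
  (S : set G) (cptS : compact S) (symS : symmetric_set S)
  (genS : generating_set S)
  (mu : {measure set (borelType G) -> \bar R}) (haar_mu : left_haar mu)
  (p : R) (p1 : 1 < p)
  (f : R -> R) (f_ge0 : forall t, 0 <= t -> 0 <= f t)
  (f_nd : forall s t, 0 <= s -> s <= t -> f s <= f t)
  (f_int : (\int[lebesgue_measure]_(t in `[1%R, +oo[)
              (((f t)%:E / isoperimetric_profile mu S p t) `^ p * (t^-1)%:E)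
            < +oo)%E) :
  exists b : G -> LspaceType mu (exponent_ge1 p1),
    left_regular_cocycle b /\ asymp_le (EFin \o f) (compression S b).
Proof.
have [[n bnd]|/forallNP unbnd] := pselect (exists n, forall g, nat_ball S n g).
  exact: cocycle_bounded bnd.
apply: cocycle_unbounded => // n; apply: contrapT => /forallNP ng.
by apply: (unbnd n) => g; apply: contrapT; exact: ng.
Qed.
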